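(* Let $\mathcal C$ be a coboundary category and let $A_1,\dots,A_n\in\mathcal C$. For every $\rho\in J_n$ (the $n$-fruit cactus group) there is a natural isomorphism $$\tau(\rho;A_1,\dots,A_n):A_1\otimes\cdots\otimes A_n\to A_{\widehat\rho(1)}\otimes\cdots\otimes A_{\widehat\rho(n)},$$ with $\tau(s_{p,q};A_1,\dots,A_n)$ equal to the interval reversal $s_{p,q}$ for the generators, satisfying $$\tau(\rho';A_{\widehat\rho(1)},\dots,A_{\widehat\rho(n)})\circ\tau(\rho;A_1,\dots,A_n)=\tau(\rho\rho';A_1,\dots,A_n)$$ for all $\rho,\rho'\in J_n$. These natural isomorphisms are exactly those which can be generated using the commutor, i.e. exactly the composites of the natural isomorphisms $\sigma_{p,r,q}$.
   Context: A coboundary category is a monoidal category $(\mathcal C,\otimes,1)$ with associator $\alpha$, unit isomorphisms $\eta_R:1\otimes A\to A$, $\eta_L:A\otimes1\to A$, and natural isomorphisms $\sigma_{A,B}:A\otimes B\to B\otimes A$ (the commutor) such that $\sigma_{B,A}\circ\sigma_{A,B}=1$, the cactus axiom $\sigma_{A,C\otimes B}\circ(1\otimes\sigma_{B,C})=\sigma_{B\otimes A,C}\circ(\sigma_{A,B}\otimes1)$ holds (as maps $A\otimes B\otimes C\to C\otimes B\otimes A$, inserting associators), and $\eta_L^{-1}\circ\eta_R=\sigma_{1,A}$. Parentheses in iterated tensor products are dropped using the unique coherence isomorphisms, and $\otimes$ may be denoted by concatenation. For $1\le p\le r<q\le n$, $\sigma_{p,r,q}$ is the natural isomorphism $$1\otimes\sigma_{A_p\cdots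 A_r,\,A_{r+1}\cdots A_q}\otimes1:\ A_1\cdots A_{p-1}A_p\cdots A_rA_{r+1}\cdots A_qA_{q+1}\cdots A_n\to A_1\cdots A_{p-1}A_{r+1}\cdots A_qA_p\cdots A_rA_{q+1}\cdots A_n.$$ The interval reversals $s_{p,q}:A_1\cdots A_{p-1}A_p\cdots A_qA_{q+1}\cdots A_n\to A_1\cdots A_{p-1}A_qA_{q-1}\cdots A_pA_{q+1}\cdots A_n$ are defined recursively by $s_{p,p}=1$, $s_{p,p+1}=\sigma_{p,p,p+1}$, and $s_{p,q}=\sigma_{p,p,q}\circ s_{p+1,q}$ for $q-p>1$. The cactus group $J_n$ is the group with generators $s_{p,q}$ for $1\le p<q\le n$ and relations: (1) $s_{p,q}^2=1$; (2) $s_{p,q}s_{k,l}=s_{k,l}s_{p,q}$ if $p<q$ and $k<l$ are disjoint ($q<k$ or $l<p$); (3) $s_{p,q}s_{k,l}=s_{m,m'}s_{p,q}$ if $p\le k<l\le q$, where $m=\widehat s_{p,q}(l)$, $m'=\widehat s_{p,q}(k)$. Here $\widehat s_{p,q}\in S_n$ is the permutation with $\widehat s_{p,q}(i)=p+q-i$ for $p\le i\le q$ and $\widehat s_{p,q}(i)=i$ otherwise. The map $s_{p,q}\mapsto\widehat s_{p,q}$ extends to a group homomorphism $J_n\to S_n$, $\rho\mapsto\widehat\rho$ (permutations composed as functions). *)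

(* Defs.v *)
From HB Require Import structures.
From mathcomp Require Import all_boot all_fingroup.
From mathcomp Require Import boolp zify.

Set Implicit Arguments.
Unset Strict Implicit.
Unset Printing Implicit Defensive.

Declare Scope cat_scope.
Delimit Scope cat_scope with cat.
Local Open Scope cat_scope.
Local Open Scope quotient_scope.

Reserved Notation "g ∘ f" (at level 50, left associativity).
Reserved Notation "X ⊗ Y" (at level 40, left associativity).
Reserved Notation "f ⊗₁ g" (at level 40, left associativity).
Reserved Notation "θ ≡ θ'" (at level 70, no associativity).

Record category := Category {
  Ob :> Type;
  Hom : Ob -> Ob -> Type;
  idm : forall X, Hom X X;
  compm : forall X Y Z, Hom Y Z -> Hom X Y -> Hom X Z;
  comp1m : forall X Y (f : Hom X Y), compm (idm Y) f = f;
  compm1 : forall X Y (f : Hom X Y), compm f (idm X) = f;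
  compA : forall X Y Z W (h : Hom Z W) (g : Hom Y Z) (f : Hom X Y),
    compm h (compm g f) = compm (compm h g) f }.

Arguments Hom {c} X Y.
Arguments idm {c} X.
Arguments compm {c X Y Z} g f.
Notation "g ∘ f" := (compm g f) : cat_scope.

Definition is_iso (C : category) (X Y : C) (f : Hom X Y) : Prop :=
  exists g : Hom Y X, g ∘ f = idm X /\ f ∘ g = idm Y.

Record monoidalCat := MonoidalCat {
  underlying :> category;
  unit_ob : underlying;
  tensor : underlying -> underlying -> underlying;
  tensorm : forall X X' Y Y' : underlying,
    Hom X X' -> Hom Y Y' -> Hom (tensor X Y) (tensor X' Y');
  assoc : forall X Y Z, Hom (tensor (tensor X Y) Z) (tensor X (tensor Y Z));
  assocV : forall X Y Z, Hom (tensor X (tensor Y Z)) (tensor (tensor X Y) Z);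
  lunit : forall X, Hom (tensor unit_ob X) X;
  lunitV : forall X, Hom X (tensor unit_ob X);
  runit : forall X, Hom (tensor X unit_ob) X;
  runitV : forall X, Hom X (tensor X unit_ob);
  tensorm1 : forall X Y, tensorm (idm X) (idm Y) = idm (tensor X Y);
  tensormM : forall X X' X'' Y Y' Y'' (f' : Hom X' X'') (f : Hom X X')
      (g' : Hom Y' Y'') (g : Hom Y Y'),
    tensorm (f' ∘ f) (g' ∘ g) = tensorm f' g' ∘ tensorm f g;
  assocK : forall X Y Z, assocV X Y Z ∘ assoc X Y Z = idm _;
  assocVK : forall X Y Z, assoc X Y Z ∘ assocV X Y Z = idm _;
  lunitK : forall X, lunitV X ∘ lunit X = idm _;
  lunitVK : forall X, lunit X ∘ lunitV X = idm _;
  runitK : forall X, runitV X ∘ runit X = idm _;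
  runitVK : forall X, runit X ∘ runitV X = idm _;
  assoc_nat : forall X X' Y Y' Z Z' (f : Hom X X') (g : Hom Y Y')
      (h : Hom Z Z'),
    assoc X' Y' Z' ∘ tensorm (tensorm f g) h
      = tensorm f (tensorm g h) ∘ assoc X Y Z;
  lunit_nat : forall X Y (f : Hom X Y),
    lunit Y ∘ tensorm (idm unit_ob) f = f ∘ lunit X;
  runit_nat : forall X Y (f : Hom X Y),
    runit Y ∘ tensorm f (idm unit_ob) = f ∘ runit X;
  pentagon : forall W X Y Z,
    tensorm (idm W) (assoc X Y Z) ∘ assoc W (tensor X Y) Z
        ∘ tensorm (assoc W X Y) (idm Z)
      = assoc W X (tensor Y Z) ∘ assoc (tensor W X) Y Z;
  triangle : forall X Y,
    tensorm (idm X) (lunit Y) ∘ assoc X unit_ob Y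
      = tensorm (runit X) (idm Y) }.

Arguments unit_ob {m}.
Arguments tensor {m} X Y.
Arguments tensorm {m X X' Y Y'} f g.
Arguments assoc {m} X Y Z.
Arguments assocV {m} X Y Z.
Arguments lunit {m} X.
Arguments lunitV {m} X.
Arguments runit {m} X.
Arguments runitV {m} X.
Notation "X ⊗ Y" := (tensor X Y) : cat_scope.
Notation "f ⊗₁ g" := (tensorm f g) : cat_scope.

(* The cactus axiom is an equation between maps                              *)
(*   (X ⊗ Y) ⊗ Z -> Z ⊗ (Y ⊗ X).                                             *)
Record coboundaryCat := CoboundaryCat {
  underlying_mon :> monoidalCat;
  commutor : forall X Y : underlying_mon, Hom (X ⊗ Y) (Y ⊗ X);
  commutor_nat : forall (X X' Y Y' : underlying_mon)
      (f : Hom X X') (g : Hom Y Y'),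
    commutor X' Y' ∘ (f ⊗₁ g) = (g ⊗₁ f) ∘ commutor X Y;
  commutorK : forall X Y, commutor Y X ∘ commutor X Y = idm (X ⊗ Y);
  cactus_axiom : forall X Y Z,
    assoc Z Y X ∘ commutor X (Z ⊗ Y) ∘ (idm X ⊗₁ commutor Y Z) ∘ assoc X Y Z
      = commutor (Y ⊗ X) Z ∘ (commutor X Y ⊗₁ idm Z);
  commutor_unit : forall X, runitV X ∘ lunit X = commutor unit_ob X }.

Arguments commutor {c} X Y.

Section IteratedTensor.
Variable C : monoidalCat.
Implicit Types s t : seq C.

(* [:: X1; X2; ...; Xn] |-> X1 ⊗ (X2 ⊗ (... ⊗ Xn)), without a trailing unit  *)
Fixpoint tens s : C :=
  match s with
  | [::] => unit_ob
  | [:: X] => X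
  | X :: (_ :: _) as s' => X ⊗ tens s'
  end.

Fixpoint tens_map I (A B : I -> C) (f : forall i, Hom (A i) (B i))
    (u : seq I) : Hom (tens (map A u)) (tens (map B u)) :=
  match u with
  | [::] => idm unit_ob
  | i :: u' =>
    match u' return Hom (tens (map A u')) (tens (map B u')) ->
        Hom (tens (map A (i :: u'))) (tens (map B (i :: u'))) with
    | [::] => fun=> f i
    | _ :: _ => fun g => f i ⊗₁ g
    end (tens_map f u')
  end.

Definition cast s t (e : s = t) : Hom (tens s) (tens t) :=
  let: erefl := e in idm (tens s).

(* The coherence isomorphism tens s ⊗ tens t -> tens (s ++ t) and its inverse *)
Fixpoint join s t : Hom (tens s ⊗ tens t) (tens (s ++ t)) :=
  match s with
  | [::] => lunit (tens t)
  | X :: s' =>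
    match s' return Hom (tens s' ⊗ tens t) (tens (s' ++ t)) ->
        Hom (tens (X :: s') ⊗ tens t) (tens (X :: s' ++ t)) with
    | [::] => fun=>
      match t return Hom (X ⊗ tens t) (tens (X :: t)) with
      | [::] => runit X
      | _ :: _ => idm _
      end
    | _ :: _ => fun f => (idm X ⊗₁ f) ∘ assoc _ _ _
    end (join s' t)
  end.

Fixpoint split s t : Hom (tens (s ++ t)) (tens s ⊗ tens t) :=
  match s with
  | [::] => lunitV (tens t)
  | X :: s' =>
    match s' return Hom (tens (s' ++ t)) (tens s' ⊗ tens t) ->
        Hom (tens (X :: s' ++ t)) (tens (X :: s') ⊗ tens t) with
    | [::] => fun=>
      match t return Hom (tens (X :: t)) (X ⊗ tens t) with
      | [::] => runitV X
      | _ :: _ => idm _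
      end
    | _ :: _ => fun f => assocV _ _ _ ∘ (idm X ⊗₁ f)
    end (split s' t)
  end.

Lemma joinK s t : split s t ∘ join s t = idm _.
Proof.
elim: s => [|X s IH]; first exact: lunitK.
case: s IH => [|Y s] IH.
  by case: t {IH} => [|Z t]; [exact: runitK | exact: comp1m].
set s' := Y :: s in IH *.
rewrite -[join _ t]/((idm X ⊗₁ join s' t) ∘ assoc _ _ _).
rewrite -[split _ t]/(assocV _ _ _ ∘ (idm X ⊗₁ split s' t)).
by rewrite compA -(compA (assocV _ _ _)) -tensormM IH comp1m tensorm1 compm1
  assocK.
Qed.

Lemma splitK s t : join s t ∘ split s t = idm _.
Proof.
elim: s => [|X s IH]; first exact: lunitVK.
case: s IH => [|Y s] IH.
  by case: t {IH} => [|Z t]; [exact: runitVK | exact: comp1m].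
set s' := Y :: s in IH *.
rewrite -[join _ t]/((idm X ⊗₁ join s' t) ∘ assoc _ _ _).
rewrite -[split _ t]/(assocV _ _ _ ∘ (idm X ⊗₁ split s' t)).
by rewrite compA -(compA _ _ (assocV _ _ _)) assocVK compm1 -tensormM IH comp1m
  tensorm1.
Qed.

End IteratedTensor.

(* 1 ⊗ σ ⊗ 1, where σ exchanges the tensor products of the lists t and t'    *)
Definition commutor_blocks (C : coboundaryCat) (s t t' u : seq C) :
    Hom (tens (s ++ (t ++ t') ++ u)) (tens (s ++ (t' ++ t) ++ u)) :=
  join s ((t' ++ t) ++ u)
  ∘ (idm (tens s)
     ⊗₁ (join (t' ++ t) u
         ∘ ((join t' t ∘ commutor (tens t) (tens t') ∘ split t t')
            ⊗₁ idm (tens u))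
         ∘ split (t ++ t') u))
  ∘ split s ((t ++ t') ++ u).

(* Positions are numbered from 0. For p <= r < q < size s, the list s is the *)
(* concatenation of s_0 .. s_(p-1), s_p .. s_r, s_(r+1) .. s_q and           *)
(* s_(q+1) .. (size s - 1).                                                  *)
Section Blocks.
Variables (T : Type) (p r q : nat) (s : seq T).

Definition block0 := take p s.
Definition block1 := take (r.+1 - p) (drop p s).
Definition block2 := take (q - r) (drop (r.+1 - p) (drop p s)).
Definition block3 := drop (q - r) (drop (r.+1 - p) (drop p s)).

Definition swap_blocks := block0 ++ (block2 ++ block1) ++ block3.

Lemma cat_blocks : s = block0 ++ (block1 ++ block2) ++ block3.
Proof. by rewrite -catA !cat_take_drop. Qed.

Lemma size_swap_blocks : size swap_blocks = size s.
Proof.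
by rewrite [in RHS]cat_blocks !size_cat (addnC (size block1)).
Qed.

End Blocks.

Lemma map_swap_blocks T T' (f : T -> T') p r q s :
  map f (swap_blocks p r q s) = swap_blocks p r q (map f s).
Proof.
by rewrite !map_cat /block0 /block1 /block2 /block3 !(map_take, map_drop).
Qed.

(* The i-th factor after exchanging the blocks p..r and r+1..q is the factor *)
(* that was at position swap_idx p r q i (see swap_idxE).                    *)
Definition swap_idx n (p r q : nat) (i : 'I_n) : 'I_n :=
  nth i (swap_blocks p r q (enum 'I_n)) i.

Lemma map_swap_idx n p r q :
  map (@swap_idx n p r q) (enum 'I_n) = swap_blocks p r q (enum 'I_n).
Proof.
have sz : size (swap_blocks p r q (enum 'I_n)) = n.
  by rewrite size_swap_blocks size_enum_ord.
have x0 : 'I_n -> map (@swap_idx n p r q) (enum 'I_n)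
    = swap_blocks p r q (enum 'I_n).
  move=> x0; apply: (@eq_from_nth _ x0); rewrite size_map size_enum_ord ?sz //.
  move=> i lti; rewrite (nth_map x0) ?size_enum_ord // /swap_idx.
  by rewrite nth_enum_ord //; apply: set_nth_default; rewrite sz.
case: n sz x0 => [|n] sz; last by apply; apply: ord0.
by move/size0nil: (sz) => -> _; apply/size0nil; rewrite size_map size_enum_ord.
Qed.

Lemma swap_idxE n p r q (i : 'I_n) : p <= r -> r < q -> q < n ->
  val (swap_idx p r q i) =
    if p <= i < p + (q - r) then i + (r.+1 - p)
    else if p + (q - r) <= i <= q then i - (q - r)
    else i.
Proof.
move=> pr rq qn; rewrite /swap_idx -(nth_map i 0); last first.
  by rewrite size_swap_blocks size_enum_ord.
rewrite map_swap_blocks val_enum_ord /swap_blocks /block0 /block1 /block2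
  /block3.
have iE : i < n by [].
rewrite !drop_iota !take_iota !nth_cat !size_cat !size_iota.
have -> : minn p n = p by lia.
have -> : minn (r.+1 - p) (n - p) = r.+1 - p by lia.
have -> : minn (q - r) (n - p - (r.+1 - p)) = q - r by lia.
do !case: ifP => ?; rewrite ?nth_iota; lia.
Qed.

Definition rev_fun n (p q i : 'I_n) : 'I_n :=
  if p <= i <= q then insubd i (p + q - i) else i.

Lemma rev_funK n (p q : 'I_n) : involutive (rev_fun p q).
Proof.
move=> i; apply: val_inj; rewrite /rev_fun.
have [pq|npq] := boolP (p <= i <= q); last by rewrite (negbTE npq).
have lt : p + q - i < n by have := ltn_ord q; lia.
have E : val (insubd i (p + q - i)) = p + q - i by rewrite val_insubd lt.
have pq' : p <= (insubd i (p + q - i) : 'I_n) <= q.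
  by move: E => /= ->; lia.
rewrite pq' val_insubd; move: E => /= ->.
by have := ltn_ord i; case: ifP; lia.
Qed.

Definition rev_perm n (p q : 'I_n) : 'S_n := perm (can_inj (@rev_funK n p q)).

(* In a word, (x, false) and (x, true) stand for the generator x and its     *)
(* formal inverse; presGroup R is the group generated by X subject to the    *)
(* relations u = v for R u v.                                                *)
Section Presentation.
Variables (X : choiceType) (R : seq X -> seq X -> Prop).

Definition word := seq (X * bool).

Definition pos_word (u : seq X) : word := [seq (x, false) | x <- u].
Definition inv_word (w : word) : word := rev [seq (x.1, ~~ x.2) | x <- w].

Inductive pres_eq : word -> word -> Prop :=
| pres_rel u v : R u v -> pres_eq (pos_word u) (pos_word v)
| pres_cancel x b : pres_eq [:: (x, b); (x, ~~ b)] [::]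
| pres_cat w1 w1' w2 w2' :
    pres_eq w1 w1' -> pres_eq w2 w2' -> pres_eq (w1 ++ w2) (w1' ++ w2')
| pres_refl w : pres_eq w w
| pres_sym w w' : pres_eq w w' -> pres_eq w' w
| pres_trans w1 w2 w3 : pres_eq w1 w2 -> pres_eq w2 w3 -> pres_eq w1 w3.

Definition pres_eqb (w w' : word) : bool := `[< pres_eq w w' >].

Lemma pres_eqb_refl : reflexive pres_eqb.
Proof. by move=> w; apply/asboolP; apply: pres_refl. Qed.

Lemma pres_eqb_sym : symmetric pres_eqb.
Proof.
by move=> w w'; apply/asboolP/asboolP; apply: pres_sym.
Qed.

Lemma pres_eqb_trans : transitive pres_eqb.
Proof.
move=> w2 w1 w3 /asboolP w12 /asboolP w23.
by apply/asboolP; apply: pres_trans w23.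
Qed.

Canonical pres_equiv :=
  EquivRel pres_eqb pres_eqb_refl pres_eqb_sym pres_eqb_trans.

Definition presGroup := {eq_quot pres_equiv}.

HB.instance Definition _ := Choice.on presGroup.

Definition pres_class (w : word) : presGroup := \pi_({eq_quot pres_equiv}) w.
Definition pres_gen (x : X) : presGroup := pres_class [:: (x, false)].

Lemma pres_classP w w' : pres_class w = pres_class w' <-> pres_eq w w'.
Proof.
split=> [/eqP|ww']; first by rewrite eqmodE => /asboolP.
by apply/eqP; rewrite eqmodE; apply/asboolP.
Qed.

Definition pres_repr (g : presGroup) : word := generic_quotient.repr g.

Lemma pres_reprK (g : presGroup) : pres_class (pres_repr g) = g.
Proof. exact: reprK. Qed.

Lemma pres_repr_class w : pres_eq (pres_repr (pres_class w)) w.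
Proof. by apply/pres_classP; rewrite pres_reprK. Qed.

Lemma inv_word_cat w w' : inv_word (w ++ w') = inv_word w' ++ inv_word w.
Proof. by rewrite /inv_word map_cat rev_cat. Qed.

Lemma inv_wordK : involutive inv_word.
Proof.
move=> w; rewrite /inv_word map_rev revK -map_comp -[RHS]map_id.
by apply: eq_map => -[x b] /=; rewrite negbK.
Qed.

Lemma pres_mulV w : pres_eq (w ++ inv_word w) [::].
Proof.
elim: w => [|[x b] w IH]; first exact: pres_refl.
rewrite -cat1s inv_word_cat -catA.
apply: (pres_trans (w2 := [:: (x, b)] ++ ([::] ++ inv_word [:: (x, b)]))).
  by apply: pres_cat (pres_refl _) _; rewrite catA; apply: pres_cat IH _;
    apply: pres_refl.
exact: pres_cancel.
Qed.

Lemma pres_Vmul w : pres_eq (inv_word w ++ w) [::].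
Proof. by rewrite -{2}(inv_wordK w); apply: pres_mulV. Qed.

Lemma pres_inv w w' : pres_eq w w' -> pres_eq (inv_word w) (inv_word w').
Proof.
move=> ww'; apply: (pres_trans (w2 := inv_word w ++ (w' ++ inv_word w'))).
  rewrite -{1}[inv_word w]cats0; apply: pres_cat (pres_refl _) _.
  by apply: pres_sym; apply: pres_mulV.
rewrite catA -{2}[inv_word w']cat0s; apply: pres_cat (pres_refl _).
apply: pres_trans (pres_Vmul w); apply: pres_cat (pres_refl _) _.
exact: pres_sym.
Qed.

Definition pres_mul (g h : presGroup) := pres_class (pres_repr g ++ pres_repr h).
Definition pres_one := pres_class [::].
Definition pres_inverse (g : presGroup) := pres_class (inv_word (pres_repr g)).

Lemma pres_mulA : associative pres_mul.
Proof.
move=> g h k; apply/pres_classP.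
apply: (pres_trans (w2 := pres_repr g ++ (pres_repr h ++ pres_repr k))).
  by apply: pres_cat (pres_refl _) _; apply: pres_repr_class.
rewrite catA; apply: pres_cat (pres_refl _); apply: pres_sym.
exact: pres_repr_class.
Qed.

Lemma pres_mul1 : left_id pres_one pres_mul.
Proof.
move=> g; rewrite -[RHS]pres_reprK; apply/pres_classP.
rewrite -[X in pres_eq _ X]cat0s.
by apply: pres_cat (pres_refl _); apply: pres_repr_class.
Qed.

Lemma pres_mulg1 : right_id pres_one pres_mul.
Proof.
move=> g; rewrite -[RHS]pres_reprK; apply/pres_classP.
rewrite -[X in pres_eq _ X]cats0.
by apply: pres_cat (pres_refl _) _; apply: pres_repr_class.
Qed.

Lemma pres_mulVg : left_inverse pres_one pres_inverse pres_mul.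
Proof.
move=> g; apply/pres_classP; apply: pres_trans (pres_Vmul (pres_repr g)).
by apply: pres_cat (pres_refl _); apply: pres_repr_class.
Qed.

Lemma pres_mulgV : right_inverse pres_one pres_inverse pres_mul.
Proof.
move=> g; apply/pres_classP; apply: pres_trans (pres_mulV (pres_repr g)).
by apply: pres_cat (pres_refl _) _; apply: pres_repr_class.
Qed.

HB.instance Definition _ := isGroup.Build presGroup
  pres_mulA pres_mul1 pres_mulg1 pres_mulVg pres_mulgV.

Local Open Scope group_scope.

Lemma pres_class_cat w w' :
  pres_class (w ++ w') = pres_class w * pres_class w'.
Proof.
apply/pres_classP; apply: pres_cat; apply: pres_sym; exact: pres_repr_class.
Qed.

Lemma pres_class_pos u :
  pres_class (pos_word u) = \prod_(x <- u) pres_gen x.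
Proof.
elim: u => [|x u IH]; first by rewrite big_nil.
by rewrite big_cons -IH -pres_class_cat.
Qed.

Lemma pres_relation u v : R u v ->
  \prod_(x <- u) pres_gen x = \prod_(x <- v) pres_gen x.
Proof.
by move=> uv; rewrite -!pres_class_pos; apply/pres_classP; apply: pres_rel.
Qed.

Section Lift.
Variables (H : groupType) (f : X -> H).
Hypothesis fR : forall u v, R u v ->
  \prod_(x <- u) f x = \prod_(x <- v) f x.

Definition word_val (w : word) : H :=
  \prod_(x <- w) (if x.2 then (f x.1)^-1 else f x.1).

Lemma word_val_cat w w' : word_val (w ++ w') = word_val w * word_val w'.
Proof. exact: big_cat. Qed.

Lemma word_val_eq w w' : pres_eq w w' -> word_val w = word_val w'.
Proof.
elim=> // {w w'} [u v uv|x b|w1 w1' w2 w2' _ e1 _ e2|w1 w2 w3 _ -> //].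
- by rewrite /word_val !big_map /=; apply: fR.
- rewrite /word_val !big_cons !big_nil /= mulg1.
  by case: b; rewrite ?mulgV ?mulVg.
- by rewrite !word_val_cat e1 e2.
Qed.

Definition pres_lift (g : presGroup) : H := word_val (pres_repr g).

Lemma pres_lift_gen x : pres_lift (pres_gen x) = f x.
Proof.
by rewrite /pres_lift (word_val_eq (pres_repr_class _)) /word_val big_seq1.
Qed.

Lemma pres_liftM g h : pres_lift (g * h) = pres_lift g * pres_lift h.
Proof.
by rewrite /pres_lift (word_val_eq (pres_repr_class _)) word_val_cat.
Qed.

End Lift.
End Presentation.

Definition cactus_gen n := {pq : 'I_n * 'I_n | pq.1 < pq.2}.

Inductive cactus_rel n : seq (cactus_gen n) -> seq (cactus_gen n) -> Prop :=
| cactus_invol (g : cactus_gen n) : cactus_rel [:: g; g] [::]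
| cactus_disjoint (g h : cactus_gen n) :
    (val g).2 < (val h).1 \/ (val h).2 < (val g).1 ->
    cactus_rel [:: g; h] [:: h; g]
| cactus_nested (g h h' : cactus_gen n) :
    (val g).1 <= (val h).1 -> (val h).2 <= (val g).2 ->
    (val h').1 = rev_perm (val g).1 (val g).2 (val h).2 ->
    (val h').2 = rev_perm (val g).1 (val g).2 (val h).1 ->
    cactus_rel [:: g; h] [:: h'; g].

Definition cactus n := presGroup (@cactus_rel n).
HB.instance Definition _ n := Group.on (cactus n).

Definition cactus_s n (p q : 'I_n) (lt_pq : p < q) : cactus n :=
  @pres_gen (cactus_gen n) (@cactus_rel n)
    (Sub ((p, q) : 'I_n * 'I_n) lt_pq).

Section CactusPerm.
Variable n : nat.
Local Open Scope group_scope.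

Definition gen_perm (g : cactus_gen n) : 'S_n :=
  rev_perm (val g).1 (val g).2.

Lemma gen_permK g : gen_perm g * gen_perm g = 1.
Proof. by apply/permP => i; rewrite !permE /= !permE rev_funK. Qed.

Lemma cactus_rel_perm u v : @cactus_rel n u v ->
  \prod_(g <- u) gen_perm g = \prod_(g <- v) gen_perm g.
Proof.
have revE (p q i : 'I_n) :
    val (rev_perm p q i) = (if p <= i <= q then p + q - i else i)%N.
  rewrite permE /rev_fun; case: ifP => // h; rewrite val_insubd.
  by have := ltn_ord q; case: ifP; lia.
case=> [g|[[p q] /= pq] [[k l] /= kl] /= dis|
        [[p q] /= pq] [[k l] /= kl] [[k' l'] /= kl'] /= pk lq ek el];
  rewrite !big_cons !big_nil !mulg1 ?gen_permK //.
  apply/permP => i; rewrite !permM /gen_perm /=; apply: val_inj.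
  by rewrite !revE; do !case: ifP; lia.
have {}ek := congr1 val ek; have {}el := congr1 val el.
rewrite !revE /= in ek el.
apply/permP => i; rewrite !permM /gen_perm /=; apply: val_inj.
rewrite !revE ek el.
have := ltn_ord l; have := ltn_ord q; do !case: ifP; lia.
Qed.

(* The product of 'S_n is composition in diagrammatic order, whence the      *)
(* inverse: cactus_perm is a morphism for the composition of functions       *)
(* (cactus_permM), sending s_(p,q) to the reversal of [p, q] (cactus_perm_s). *)
Definition cactus_perm (rho : cactus n) : 'S_n :=
  (pres_lift gen_perm rho)^-1.

Lemma cactus_permM (rho rho' : cactus n) :
  cactus_perm (rho * rho') =1 cactus_perm rho \o cactus_perm rho'.
Proof.
move=> i; rewrite /cactus_perm (pres_liftM cactus_rel_perm) invMg.
by rewrite permM.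
Qed.

Lemma cactus_perm_s (p q : 'I_n) (lt_pq : p < q) :
  cactus_perm (cactus_s lt_pq) = rev_perm p q.
Proof.
rewrite /cactus_perm (pres_lift_gen cactus_rel_perm).
by apply/eqP; rewrite eq_invg_mul gen_permK.
Qed.

End CactusPerm.

Section Transformations.
Variables (C : coboundaryCat) (n : nat).

Definition tensI (A : 'I_n -> C) : C := tens [seq A i | i <- enum 'I_n].

Definition tensI_map (A B : 'I_n -> C) (f : forall i, Hom (A i) (B i)) :
    Hom (tensI A) (tensI B) :=
  tens_map f (enum 'I_n).

(* Families of maps A_1 ⊗ ... ⊗ A_n -> A_w(1) ⊗ ... ⊗ A_w(n) *)
Definition transf (w : 'I_n -> 'I_n) : Type :=
  forall A : 'I_n -> C, Hom (tensI A) (tensI (A \o w)).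

Definition natural_iso w (th : transf w) : Prop :=
  (forall (A B : 'I_n -> C) (f : forall i, Hom (A i) (B i)),
     th B ∘ tensI_map f = tensI_map (fun i => f (w i)) ∘ th A)
  /\ forall A, is_iso (th A).

Definition reindex (w w' : 'I_n -> 'I_n) (e : w =1 w') (A : 'I_n -> C) :
    Hom (tensI (A \o w)) (tensI (A \o w')) :=
  cast (eq_map (fun i => congr1 A (e i)) (enum 'I_n)).

(* Equality of families whose index functions are only pointwise equal *)
Definition transf_eq w w' (th : transf w) (th' : transf w') : Prop :=
  exists e : w =1 w', forall A, reindex e A ∘ th A = th' A.

Definition transf_id : transf id := fun A => idm (tensI A).

Definition transf_comp w w' (th : transf w) (th' : transf w') :
    transf (w \o w') :=
  fun A => th' (A \o w) ∘ th A.

Lemma map_comp_swap_idx p r q (A : 'I_n -> C) :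
  swap_blocks p r q [seq A i | i <- enum 'I_n]
    = [seq (A \o swap_idx p r q) i | i <- enum 'I_n].
Proof. by rewrite -map_swap_blocks -map_swap_idx -map_comp. Qed.

(* σ_(p,r,q), for 0 <= p <= r < q < n *)
Definition sigma (p r q : nat) : transf (swap_idx p r q) := fun A =>
  let s := [seq A i | i <- enum 'I_n] in
  cast (map_comp_swap_idx p r q A)
  ∘ commutor_blocks (block0 p s) (block1 p r s) (block2 p r q s)
      (block3 p r q s)
  ∘ cast (cat_blocks p r q s).

(* interval_rev_rec d p is s_(p, p+d). *)
Fixpoint interval_rev_idx (d p : nat) : 'I_n -> 'I_n :=
  match d with
  | 0 => id
  | 1 => swap_idx p p p.+1
  | d'.+1 => interval_rev_idx d' p.+1 \o swap_idx p p (p + d)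
  end.

Fixpoint interval_rev_rec (d p : nat) : transf (interval_rev_idx d p) :=
  match d return transf (interval_rev_idx d p) with
  | 0 => transf_id
  | d'.+1 =>
    match d' return transf (interval_rev_idx d' p.+1) ->
        transf (interval_rev_idx d'.+1 p) with
    | 0 => fun=> sigma p p p.+1
    | d''.+1 => fun th => transf_comp th (sigma p p (p + d''.+2))
    end (interval_rev_rec d' p.+1)
  end.

Definition interval_rev (p q : nat) : transf (interval_rev_idx (q - p) p) :=
  interval_rev_rec (q - p) p.

Inductive sigma_composite : forall w, transf w -> Prop :=
| sigma_composite_id : sigma_composite transf_id
| sigma_composite_comp w (th : transf w) (p r q : nat) :
    p <= r -> r < q -> q < n ->
    sigma_composite th -> sigma_composite (transf_comp th (sigma p r q))
| sigma_composite_eq w w' (th : transf w) (th' : transf w') :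
    transf_eq th th' -> sigma_composite th -> sigma_composite th'.

End Transformations.

Arguments transf_id C n : clear implicits.
Arguments sigma C n p r q : clear implicits.
Arguments interval_rev C n p q : clear implicits.
Notation "θ ≡ θ'" := (transf_eq θ θ') : cat_scope.

(* Main.v *)
(* Composable maps between iterated tensor products are treated as arrows of  *)
(* a strict monoidal category whose objects are the lists of factors; the     *)
(* pentagon and the unit axioms make the tensor product of arrows strictly    *)
(* associative and unital. There the reversal pi_s : s -> rev s is defined by *)
(* pi_(X::s) = sigma_(X, rev s) (1 ⊗ pi_s), and the cactus axiom yields       *)
(*   pi_(s ++ t) = sigma_(rev s, rev t) (pi_s ⊗ pi_t).                        *)
(* With naturality and sigma^2 = 1 this gives pi_(rev s) pi_s = 1 and         *)
(*   (1 ⊗ pi_(rev t) ⊗ 1) pi_(s ++ t ++ u)                                    *)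
(*     = pi_(s ++ rev t ++ u) (1 ⊗ pi_t ⊗ 1),                                 *)
(* which are the relations of the cactus group, the commutation of disjoint   *)
(* reversals being bifunctoriality. The same formula expresses sigma by three *)
(* reversals, so reversals and commutors generate the same transformations.   *)

Require Import Defs.
From mathcomp Require Import all_boot all_fingroup.
From mathcomp Require Import boolp zify.
Import Defs.

Set Implicit Arguments.
Unset Strict Implicit.
Unset Printing Implicit Defensive.

Local Open Scope cat_scope.

Reserved Notation "P ⊙ Q" (at level 50, left associativity).
Reserved Notation "P ⊠ Q" (at level 40, left associativity).

(** Words in the generators act on lists of objects, and the work is to check that this action
    respects the three cactus relations. Since [join_assoc] and [join_nil] make the coherence maps
    agree, arrows between iterated tensor products form a strict monoidal category ([ajuxt_comp],
    [ajuxtA], [ajuxt_nilr]), and brackets disappear.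

    There the cactus axiom gives [arev_cat]: reversing a concatenation means reversing both pieces
    and exchanging them. Involutivity ([arevK]) and the nested relation ([arev_nested]) follow by
    naturality and σ² = 1; disjoint reversals commute by bifunctoriality. Hence the arrow of a word
    depends only on its class in the cactus group ([act_word_eq]), and [tau] is the arrow of any
    representative. Concatenation of words gives the composition law, inverse words give inverses,
    and the recursion for s_(p,q) matches the one defining [arev].

    For the last clause, each reversal is by definition a composite of commutors, and conversely
    [acommutor_blocks_arev] writes σ_(p,r,q) as reversing both blocks and then their union. *)

Lemma compm_epi (C : category) (X Y Z : C) (h : Hom X Y) (k : Hom Y X)
    (f g : Hom Y Z) :
  h ∘ k = idm Y -> f ∘ h = g ∘ h -> f = g.
Proof.
by move=> hk /(congr1 (fun u => u ∘ k)); rewrite -!compA hk !compm1.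
Qed.

Lemma compm_mono (C : category) (X Y Z : C) (h : Hom Y Z) (k : Hom Z Y)
    (f g : Hom X Y) :
  k ∘ h = idm Y -> h ∘ f = h ∘ g -> f = g.
Proof.
by move=> kh /(congr1 (fun u => k ∘ u)); rewrite !compA kh !comp1m.
Qed.

(** * Coherence of [join] in a monoidal category *)

Section Coherence.
Variable C : monoidalCat.
Implicit Types X Y Z : C.

Lemma tensorm_idl X Y Y' Y'' (g : Hom Y' Y'') (f : Hom Y Y') :
  idm X ⊗₁ (g ∘ f) = (idm X ⊗₁ g) ∘ (idm X ⊗₁ f).
Proof. by rewrite -tensormM comp1m. Qed.

Lemma tensorm_idr X Y Y' Y'' (g : Hom Y' Y'') (f : Hom Y Y') :
  (g ∘ f) ⊗₁ idm X = (g ⊗₁ idm X) ∘ (f ⊗₁ idm X).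
Proof. by rewrite -tensormM comp1m. Qed.

Lemma unit_tensor_inj X Y (f g : Hom X Y) :
  idm unit_ob ⊗₁ f = idm unit_ob ⊗₁ g -> f = g.
Proof.
move=> fg; apply: (compm_epi (lunitVK X)).
by rewrite -!lunit_nat fg.
Qed.

Lemma tensor_unit_inj X Y (f g : Hom X Y) :
  f ⊗₁ idm unit_ob = g ⊗₁ idm unit_ob -> f = g.
Proof.
move=> fg; apply: (compm_epi (runitVK X)).
by rewrite -!runit_nat fg.
Qed.

(** Kelly's argument: tensoring with the unit on the left is faithful ([unit_tensor_inj]), and after
    doing so the equation follows from pentagon and triangle. *)
Lemma lunit_tensor X Y :
  lunit (X ⊗ Y) ∘ assoc unit_ob X Y = lunit X ⊗₁ idm Y.
Proof.
apply: unit_tensor_inj; rewrite tensorm_idl.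
apply: (compm_epi (assocVK _ _ _)).
apply: (@compm_epi _ _ _ _ (assoc unit_ob unit_ob X ⊗₁ idm Y)
  (assocV unit_ob unit_ob X ⊗₁ idm Y)).
  by rewrite -tensorm_idr assocVK tensorm1.
rewrite -!compA (compA (_ ⊗₁ assoc _ _ _)) pentagon compA triangle.
rewrite -tensorm1 -assoc_nat.
by rewrite compA -assoc_nat -compA -tensorm_idr triangle.
Qed.

Lemma runit_tensor X Y :
  (idm X ⊗₁ runit Y) ∘ assoc X Y unit_ob = runit (X ⊗ Y).
Proof.
apply: tensor_unit_inj; rewrite tensorm_idr.
apply: (compm_mono (assocK _ _ _)).
rewrite compA assoc_nat -(triangle Y) tensorm_idl -!compA.
rewrite (compA (_ ⊗₁ assoc _ _ _)) pentagon compA -assoc_nat tensorm1 -compA.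
by rewrite triangle.
Qed.

Lemma lunit_unit : lunit unit_ob = runit (unit_ob : C).
Proof.
apply: tensor_unit_inj; rewrite -lunit_tensor -triangle.
congr (_ ∘ _); apply: (compm_mono (lunitK _)).
by rewrite lunit_nat.
Qed.

(** [tens [:: X]] is [X], not [X ⊗ unit_ob], so this is the right unit for empty [s] and the
    identity otherwise; it hides that case split. *)
Definition consm X (s : seq C) : Hom (X ⊗ tens s) (tens (X :: s)) :=
  join [:: X] s.
Definition unconsm X (s : seq C) : Hom (tens (X :: s)) (X ⊗ tens s) :=
  split [:: X] s.

Lemma consmK X s : unconsm X s ∘ consm X s = idm _.
Proof. exact: (joinK [:: X]). Qed.

Lemma unconsmK X s : consm X s ∘ unconsm X s = idm _.
Proof. exact: (splitK [:: X]). Qed.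

(* The ascription unfolds the codomain tens ((X :: s) ++ t) of join, which   *)
(* rewriting would otherwise not match with that of consm.                   *)
Definition join_consl X (s t : seq C) :
  Hom (tens (X :: s) ⊗ tens t) (tens (X :: (s ++ t))) := join (X :: s) t.

Lemma join_consE X (s t : seq C) :
  join_consl X s t ∘ (consm X s ⊗₁ idm (tens t))
  = consm X (s ++ t) ∘ (idm X ⊗₁ join s t) ∘ assoc X (tens s) (tens t).
Proof.
rewrite /join_consl /consm; case: s => [|Y s]; first by rewrite -compA triangle.
by rewrite /= tensorm1 compm1 comp1m.
Qed.

(** Keeping the target list inside the pair lets maps into lists that are only provably equal be
    compared without a cast. *)
Definition pack_to X (s : seq C) (f : Hom X (tens s)) :
    {s : seq C & Hom X (tens s)} := existT _ s f.

(** Induction on [s]: the empty case is [lunit_tensor]; the step tensors the induction hypothesis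
    with [X] and closes by the pentagon. *)
Lemma join_assoc (s t u : seq C) :
  pack_to (join s (t ++ u) ∘ (idm (tens s) ⊗₁ join t u)
           ∘ assoc (tens s) (tens t) (tens u))
  = pack_to (join (s ++ t) u ∘ (join s t ⊗₁ idm (tens u))).
Proof.
elim: s => [|X s IH].
  by rewrite /= lunit_nat -compA lunit_tensor.
pose c := consm X s.
pose d := unconsm X s.
pose a := assoc X (tens s ⊗ tens t) (tens u)
       ∘ (assoc X (tens s) (tens t) ⊗₁ idm _).
(* [F] is tensoring with [X] on the left, as an operation on packed maps, so that [IH] can be
   rewritten under it. *)
pose F (P : {l : seq C & Hom ((tens s ⊗ tens t) ⊗ tens u) (tens l)}) :=
  pack_to (consm X (projT1 P) ∘ (idm X ⊗₁ projT2 P)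
    ∘ (a ∘ ((d ⊗₁ idm _) ⊗₁ idm _))).
have cK : ((c ⊗₁ idm (tens t)) ⊗₁ idm (tens u)) ∘
    ((d ⊗₁ idm _) ⊗₁ idm _) = idm _.
  by rewrite -!tensorm_idr unconsmK !tensorm1.
have Kc : ((d ⊗₁ idm (tens t)) ⊗₁ idm (tens u)) ∘
    ((c ⊗₁ idm _) ⊗₁ idm _) = idm _.
  by rewrite -!tensorm_idr consmK !tensorm1.
have FE l (f : Hom _ (tens l)) (g : Hom _ (tens (X :: l))) :
    g ∘ ((c ⊗₁ idm _) ⊗₁ idm _) = consm X l ∘ (idm X ⊗₁ f) ∘ a ->
    pack_to g = F (pack_to f).
  move=> eg; congr existT; apply: (compm_epi cK); rewrite eg /=.
  by rewrite -!compA Kc compm1.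
transitivity (F (pack_to (join s (t ++ u) ∘ (idm (tens s) ⊗₁ join t u)
    ∘ assoc (tens s) (tens t) (tens u)))).
  apply: (FE (s ++ (t ++ u)) _
    (join_consl X s (t ++ u) ∘ (idm _ ⊗₁ join t u) ∘ assoc _ _ _)).
  rewrite -compA assoc_nat tensorm1 -compA (compA (_ ⊗₁ join t u)) -tensormM.
  rewrite comp1m compm1 -{1}[c]compm1 -{1}[join t u]comp1m tensormM.
  rewrite !compA join_consE -!compA; congr (_ ∘ _).
  rewrite -tensorm1 (compA (assoc _ _ _)) assoc_nat !tensorm_idl -!compA.
  by rewrite -pentagon -!compA.
rewrite IH; symmetry; apply: (FE ((s ++ t) ++ u) _
  (join_consl X (s ++ t) u ∘ (join_consl X s t ⊗₁ idm _))).
rewrite -compA -tensorm_idr join_consE !tensorm_idr !compA join_consE.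
rewrite !tensorm_idl -!compA; congr (_ ∘ (_ ∘ _)).
by rewrite !compA assoc_nat.
Qed.

Lemma join_nil (s : seq C) : pack_to (join s [::]) = pack_to (runit (tens s)).
Proof.
elim: s => [|X s IH]; first by rewrite /= lunit_unit.
pose F (P : {l : seq C & Hom (tens s ⊗ unit_ob) (tens l)}) :=
  pack_to (consm X (projT1 P) ∘ (idm X ⊗₁ projT2 P) ∘ assoc _ _ _
    ∘ (unconsm X s ⊗₁ idm _)).
have cK : (consm X s ⊗₁ idm unit_ob) ∘ (unconsm X s ⊗₁ idm _) = idm _.
  by rewrite -tensorm_idr unconsmK tensorm1.
have := congr1 F IH; rewrite /F /=.
rewrite -(join_consE X s [::]) -(compA (join_consl X s [::])) cK compm1 => ->.
congr existT; rewrite -(compA (consm X s)) runit_tensor -runit_nat -compA.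
by rewrite cK compm1.
Qed.
End Coherence.

(** * The strict monoidal calculus of arrows between lists *)

(* An arrow with its endpoints: equalities of arrows make sense when the     *)
(* lists of factors are only propositionally equal, so no cast is needed.    *)
Record arrow (C : monoidalCat) := Arrow {
  asrc : seq C;
  atgt : seq C;
  amor : Hom (tens asrc) (tens atgt) }.

Arguments Arrow {C s t} f : rename.

Section Arrows.
Variable C : monoidalCat.
Implicit Types (s t u v : seq C) (P Q R : arrow C).

Definition aid s : arrow C := Arrow (idm (tens s)).

(* P after Q; the junk value Q when the endpoints do not match. *)
Definition acomp P Q : arrow C :=
  if pselect (atgt Q = asrc P) is left e
  then Arrow (amor P ∘ cast e ∘ amor Q) else Q.

Definition juxt s s' t t' (f : Hom (tens s) (tens s'))
    (g : Hom (tens t) (tens t')) : Hom (tens (s ++ t)) (tens (s' ++ t')) :=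
  locked (join s' t' ∘ (f ⊗₁ g) ∘ split s t).

Lemma juxtE s s' t t' (f : Hom (tens s) (tens s'))
    (g : Hom (tens t) (tens t')) :
  juxt f g = join s' t' ∘ (f ⊗₁ g) ∘ split s t.
Proof. by rewrite /juxt -lock. Qed.

Definition ajuxt P Q : arrow C := Arrow (juxt (amor P) (amor Q)).

Local Notation "P ⊙ Q" := (acomp P Q) : cat_scope.
Local Notation "P ⊠ Q" := (ajuxt P Q) : cat_scope.

Lemma cast_id s (e : s = s) : cast e = idm (tens s).
Proof. by rewrite (Prop_irrelevance e erefl). Qed.

Lemma acompE s t u (f : Hom (tens s) (tens t)) (g : Hom (tens t) (tens u)) :
  Arrow g ⊙ Arrow f = Arrow (g ∘ f).
Proof.
by rewrite /acomp /=; case: pselect => // e; rewrite cast_id compm1.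
Qed.

Lemma asrc_comp P Q : asrc (P ⊙ Q) = asrc Q.
Proof. by rewrite /acomp; case: pselect. Qed.

Lemma atgt_comp P Q : atgt Q = asrc P -> atgt (P ⊙ Q) = atgt P.
Proof. by rewrite /acomp; case: pselect. Qed.

Lemma acomp1 P s : s = asrc P -> P ⊙ aid s = P.
Proof. by case: P => t u f /= ->; rewrite acompE compm1. Qed.

Lemma acomp1l P s : s = atgt P -> aid s ⊙ P = P.
Proof. by case: P => t u f /= ->; rewrite acompE comp1m. Qed.

Lemma acompA P Q R : atgt R = asrc Q -> atgt Q = asrc P ->
  P ⊙ (Q ⊙ R) = P ⊙ Q ⊙ R.
Proof.
case: P Q R => s t f [s' t' g] [s'' t'' h] /= e e'; subst.
by rewrite !acompE compA.
Qed.

Lemma juxt_join s s' t t' (f : Hom (tens s) (tens s'))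
    (g : Hom (tens t) (tens t')) :
  juxt f g ∘ join s t = join s' t' ∘ (f ⊗₁ g).
Proof. by rewrite juxtE -compA joinK compm1. Qed.

Lemma ajuxt_comp P P' Q Q' : atgt P' = asrc P -> atgt Q' = asrc Q ->
  (P ⊙ P') ⊠ (Q ⊙ Q') = (P ⊠ Q) ⊙ (P' ⊠ Q').
Proof.
case: P P' Q Q' => s1 s2 f [s3 s4 f'] [t1 t2 g] [t3 t4 g'] /= e e'; subst.
rewrite !acompE /ajuxt /=; congr Arrow.
by rewrite [juxt f' g']juxtE !compA juxt_join juxtE tensormM !compA.
Qed.

Lemma ajuxt_id s t : aid s ⊠ aid t = aid (s ++ t).
Proof. by rewrite /ajuxt juxtE /= tensorm1 compm1 splitK. Qed.

(* X and Y identify the endpoints of f with those of g, so that coherence    *)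
(* isomorphisms can be absorbed without casts.                               *)
Lemma arrow_conj X Y (s t s' t' : seq C) (f : Hom (tens s) (tens t))
    (g : Hom (tens s') (tens t')) (i : Hom X (tens s)) (j : Hom Y (tens t))
    (i' : Hom X (tens s')) (j' : Hom Y (tens t')) (k : Hom (tens s) X)
    (m : Hom X Y) :
  pack_to i = pack_to i' -> pack_to j = pack_to j' -> i ∘ k = idm _ ->
  f ∘ i = j ∘ m -> g ∘ i' = j' ∘ m -> Arrow f = Arrow g.
Proof.
pose S A := {s : seq C & Hom A (tens s)}.
suff H (P P' : S X) (Q Q' : S Y) (a : Hom (tens (projT1 P)) (tens (projT1 Q)))
    (a' : Hom (tens (projT1 P')) (tens (projT1 Q'))) :
    P = P' -> Q = Q' -> forall k, projT2 P ∘ k = idm _ ->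
    a ∘ projT2 P = projT2 Q ∘ m -> a' ∘ projT2 P' = projT2 Q' ∘ m ->
    Arrow a = Arrow a'.
  by move=> ei ej ik ef eg; apply: (H (pack_to i) (pack_to i')
    (pack_to j) (pack_to j') f g ei ej k).
move=> eP eQ; case: P' / eP a' => a'; case: Q' / eQ a' => a' {}k ik ea ea'.
by congr Arrow; apply: (compm_epi ik); rewrite ea ea'.
Qed.

(** Precomposed with the two bracketings of [join], both sides become [(f ⊗₁ g) ⊗₁ h] followed by
    joins; [join_assoc] identifies the joins. *)
Lemma ajuxtA P Q R : P ⊠ (Q ⊠ R) = (P ⊠ Q) ⊠ R.
Proof.
case: P Q R => s s' f [t t' g] [u u' h].
apply: (@arrow_conj _ _ _ _ _ _ _ _ _ _ _ _
  (assocV _ _ _ ∘ (idm (tens s) ⊗₁ split t u) ∘ split s (t ++ u))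
  ((f ⊗₁ g) ⊗₁ h) (join_assoc _ _ _) (join_assoc _ _ _)); rewrite /=.
- rewrite !compA -(compA _ _ (assocV _ _ _)) assocVK compm1.
  by rewrite -(compA _ _ (_ ⊗₁ split _ _)) -tensorm_idl splitK tensorm1 compm1
    splitK.
- rewrite !compA juxt_join -(compA _ _ (idm _ ⊗₁ join t u)) -tensormM juxt_join.
  by rewrite -[f ∘ _]comp1m compm1 tensormM -!compA assoc_nat.
- by rewrite compA juxt_join -!compA -!tensormM juxt_join compm1 comp1m.
Qed.

Lemma ajuxt_nill P : aid [::] ⊠ P = P.
Proof.
case: P => s t f; rewrite /ajuxt juxtE /=.
by rewrite lunit_nat -compA lunitVK compm1.
Qed.

Lemma ajuxt_nilr P : P ⊠ aid [::] = P.
Proof.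
case: P => s t f.
apply: (@arrow_conj _ _ _ _ _ _ _ _ _ _ _ _ (split s [::]) (f ⊗₁ idm _)
  (join_nil _) (join_nil _)); rewrite /=.
- exact: splitK.
- exact: (juxt_join f (idm (tens [::]))).
- by rewrite runit_nat.
Qed.

Definition arrow_between P s t (e : asrc P = s) (e' : atgt P = t) :
    Hom (tens s) (tens t) := cast e' ∘ amor P ∘ cast (esym e).

Lemma arrow_betweenK P s t (e : asrc P = s) (e' : atgt P = t) :
  Arrow (arrow_between e e') = P.
Proof.
case: P e e' => s' t' f /= e e'; subst.
by rewrite /arrow_between /= compm1 comp1m.
Qed.

(** The way back from arrows to typed maps: [arrow_between] recovers the map, its casts being
    trivial by proof irrelevance ([cast_id]). *)
Lemma Arrow_inj s t : injective (@Arrow C s t).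
Proof.
have getE f (e : asrc (Arrow f) = s) (e' : atgt (Arrow f) = t) :
    arrow_between e e' = f by rewrite /arrow_between !cast_id comp1m compm1.
move=> f g fg; have e : asrc (Arrow g) = s by [].
have e' : atgt (Arrow g) = t by [].
by rewrite -[RHS](getE g e e'); case: _ / fg e e' => e e'; rewrite getE.
Qed.

Lemma Arrow_castl s t t' (e : t = t') (f : Hom (tens s) (tens t)) :
  Arrow (cast e ∘ f) = Arrow f.
Proof. by case: t' / e; rewrite comp1m. Qed.

Lemma Arrow_castr s s' t (e : s = s') (f : Hom (tens s') (tens t)) :
  Arrow (f ∘ cast e) = Arrow f.
Proof. by case: s' / e f => f; rewrite compm1. Qed.

End Arrows.

Notation "P ⊙ Q" := (acomp P Q) : cat_scope.
Notation "P ⊠ Q" := (ajuxt P Q) : cat_scope.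

(** * Commutors and full reversals of lists *)

Section Commutor.
Variable C : coboundaryCat.
Implicit Types (s t u : seq C) (P Q R : arrow C).

Definition commutor_tens s t : Hom (tens (s ++ t)) (tens (t ++ s)) :=
  locked (join t s ∘ commutor (tens s) (tens t) ∘ split s t).

Lemma commutor_tensE s t :
  commutor_tens s t = join t s ∘ commutor (tens s) (tens t) ∘ split s t.
Proof. by rewrite /commutor_tens -lock. Qed.

Definition acommutor s t : arrow C := Arrow (commutor_tens s t).

Lemma commutor_tens_join s t :
  commutor_tens s t ∘ join s t = join t s ∘ commutor _ _.
Proof. by rewrite commutor_tensE -compA joinK compm1. Qed.

Lemma acommutor_nat P Q :
  acommutor (atgt P) (atgt Q) ⊙ (P ⊠ Q)
  = (Q ⊠ P) ⊙ acommutor (asrc P) (asrc Q).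
Proof.
case: P Q => s s' f [t t' g]; rewrite !acompE /=; congr Arrow.
apply: (compm_epi (splitK s t)).
rewrite -(compA _ (juxt f g)) juxt_join compA commutor_tens_join.
rewrite -(compA _ (commutor_tens s t)) commutor_tens_join compA juxt_join.
by rewrite -2!compA commutor_nat.
Qed.

Lemma acommutorK s t : acommutor t s ⊙ acommutor s t = aid (s ++ t).
Proof.
rewrite acompE; congr Arrow; apply: (compm_epi (splitK s t)).
rewrite -(compA _ (commutor_tens s t)) commutor_tens_join compA.
rewrite commutor_tens_join -compA commutorK.
by rewrite compm1 comp1m.
Qed.

Lemma acommutor_cactus s t u :
  acommutor s (u ++ t) ⊙ (aid s ⊠ acommutor t u)
  = acommutor (t ++ s) u ⊙ (acommutor s t ⊠ aid u).
Proof.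
rewrite !acompE.
(* [cactus_axiom] ends in [Z ⊗ (Y ⊗ X)], as does the map chosen below, so the other bracketing of
   the target is reached through [assocV]. *)
have ej := congr1 (fun P : {l : seq C & Hom _ (tens l)} =>
    pack_to (projT2 P ∘ assocV (tens u) (tens t) (tens s)))
  (join_assoc u t s).
apply: (@arrow_conj _ _ _ _ _ _ _ _ _ _ _ _ _
  (assocV _ _ _ ∘ (idm (tens s) ⊗₁ split t u) ∘ split s (t ++ u))
  (commutor (tens t ⊗ tens s) (tens u) ∘ (commutor (tens s) (tens t) ⊗₁ idm _))
  (join_assoc _ _ _) (esym ej)); rewrite /=.
- rewrite !compA -(compA _ _ (assocV _ _ _)) assocVK compm1.
  by rewrite -(compA _ _ (_ ⊗₁ split _ _)) -tensorm_idl splitK tensorm1 compm1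
    splitK.
- rewrite -cactus_axiom !compA -(compA _ (juxt _ _) (join _ _)) juxt_join.
  rewrite compA commutor_tens_join -(compA _ _ (idm _ ⊗₁ join _ _)).
  rewrite -tensorm_idl commutor_tens_join tensorm_idl !compA.
  rewrite -(compA _ (commutor _ _)) commutor_nat -!compA; do 2 congr (_ ∘ _).
  by rewrite (compA (assocV _ _ _)) assocK comp1m.
- rewrite -(compA _ _ (assocV _ _ _)) assocVK compm1 !compA.
  rewrite -(compA _ (juxt _ _) (join _ _)) juxt_join compA commutor_tens_join.
  rewrite -(compA _ _ (join _ _ ⊗₁ _)) -tensorm_idr commutor_tens_join.
  rewrite tensorm_idr !compA; congr (_ ∘ _); rewrite -!compA; congr (_ ∘ _).
  exact: commutor_nat.
Qed.

(** This is [commutor_unit]: σ_(1,X) is the composite of unit isomorphisms, which the strict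
    calculus identifies with the identity. *)
Lemma acommutor_nil s : acommutor [::] s = aid s.
Proof.
apply: (@arrow_conj _ _ _ ([::] ++ s) (s ++ [::]) s s (commutor_tens [::] s)
  (idm _) (join [::] s) (join s [::]) (lunit _) (runit _) (lunitV (tens s))
  (runitV _ ∘ lunit _) erefl (join_nil s)).
- exact: lunitVK.
- by rewrite commutor_unit commutor_tens_join.
- by rewrite compA runitVK.
Qed.

Fixpoint arev s : arrow C :=
  if s is X :: s' then acommutor [:: X] (rev s') ⊙ (aid [:: X] ⊠ arev s')
  else aid [::].

Lemma asrc_arev s : asrc (arev s) = s.
Proof. by elim: s => //= X s IH; rewrite asrc_comp /= IH. Qed.

Lemma atgt_arev s : atgt (arev s) = rev s.
Proof.
elim: s => //= X s IH; rewrite atgt_comp /= ?IH //.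
by rewrite rev_cons -cats1.
Qed.

(** Induction on [s]. Moving [X] past [rev t ++ rev s] after exchanging [rev s] and [rev t] equals,
    by the cactus axiom, moving [X] past [rev s] and then exchanging [rev s ++ [:: X]] with
    [rev t]. *)
Lemma arev_cat s t :
  arev (s ++ t) = acommutor (rev s) (rev t) ⊙ (arev s ⊠ arev t).
Proof.
elim: s => [|X s IH] /=.
  by rewrite acommutor_nil ajuxt_nill acomp1l ?atgt_arev.
have -> : arev t = aid (rev t) ⊙ arev t by rewrite acomp1l ?atgt_arev.
rewrite ajuxt_comp /= ?asrc_arev ?atgt_arev // -ajuxtA IH.
rewrite acompA /= ?rev_cons -?cats1 ?atgt_arev //.
rewrite -acommutor_cactus rev_cat -acompA /= ?atgt_comp /= ?atgt_arev //.
by rewrite -ajuxt_comp ?acomp1 /= ?atgt_arev.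
Qed.

Lemma acommutor_nilr s : acommutor s [::] = aid s.
Proof.
by have := acommutorK s [::]; rewrite acommutor_nil cats0 acomp1l ?cats0.
Qed.

Lemma arev1 X : arev [:: X] = aid [:: X].
Proof. by rewrite /= acommutor_nilr ajuxt_nilr acomp1. Qed.

(** Since [rev (X :: s)] ends in [X], [arev_cat] exhibits a second commutor; naturality brings it
    next to the first, where they cancel, leaving the induction hypothesis. *)
Lemma arevK s : arev (rev s) ⊙ arev s = aid s.
Proof.
elim: s => [|X s IH]; first by rewrite /= acomp1.
rewrite rev_cons -cats1 arev_cat revK arev1.
have := acommutor_nat (aid [:: X]) (arev (rev s)).
rewrite /= asrc_arev atgt_arev revK => nat.
have at_ s' : atgt (arev s') = rev s' by exact: atgt_arev.
have as_ s' : asrc (arev s') = s' by exact: asrc_arev.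
rewrite acompA ?asrc_comp ?atgt_comp /= ?at_ ?as_ ?revK //.
rewrite -(acompA (P := acommutor s [:: X])) /= ?at_ ?as_ ?revK //.
rewrite -nat acompA ?asrc_comp ?atgt_comp /= ?at_ ?as_ ?revK //.
rewrite acommutorK acomp1l ?asrc_comp ?atgt_comp /= ?at_ ?as_ ?revK //.
by rewrite -ajuxt_comp /= ?at_ ?as_ // IH acomp1 // ajuxt_id.
Qed.

Definition acommutor3 s t u : arrow C :=
  acommutor s (u ++ t) ⊙ (aid s ⊠ acommutor t u).

Lemma asrc_acommutor3 s t u : asrc (acommutor3 s t u) = s ++ t ++ u.
Proof. by rewrite asrc_comp. Qed.

Lemma atgt_acommutor3 s t u : atgt (acommutor3 s t u) = (u ++ t) ++ s.
Proof. by rewrite atgt_comp. Qed.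

Lemma acommutor3_nat P Q R :
  acommutor3 (atgt P) (atgt Q) (atgt R) ⊙ (P ⊠ (Q ⊠ R))
  = (R ⊠ Q ⊠ P) ⊙ acommutor3 (asrc P) (asrc Q) (asrc R).
Proof.
rewrite /acommutor3 -acompA //= -ajuxt_comp //= acomp1l // acommutor_nat.
rewrite -[P in LHS](acomp1 (erefl (asrc P))) ajuxt_comp //= acompA
  ?atgt_comp //=.
by have := acommutor_nat P (R ⊠ Q); rewrite /= => ->; rewrite acompA.
Qed.

Lemma arev_cat3 s t u :
  arev (s ++ t ++ u)
  = acommutor3 (rev s) (rev t) (rev u) ⊙ (arev s ⊠ (arev t ⊠ arev u)).
Proof.
rewrite !arev_cat rev_cat -[arev s in LHS](acomp1l (s := rev s)) ?atgt_arev //.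
by rewrite ajuxt_comp /= ?atgt_arev // acompA ?atgt_comp //= ?atgt_arev.
Qed.

(** Naturality of [acommutor3] in its middle block moves [arev (rev t)] inside; on each side the
    middle reversals then cancel by [arevK]. *)
Lemma arev_nested s t u :
  (aid (rev u) ⊠ arev (rev t) ⊠ aid (rev s)) ⊙ arev (s ++ t ++ u)
  = arev (s ++ rev t ++ u) ⊙ (aid s ⊠ (arev t ⊠ aid u)).
Proof.
have at_ s' : atgt (arev s') = rev s' by exact: atgt_arev.
have as_ s' : asrc (arev s') = s' by exact: asrc_arev.
have := acommutor3_nat (aid (rev s)) (arev (rev t)) (aid (rev u)).
rewrite /= at_ as_ revK => nat.
have E := (at_, as_, asrc_acommutor3, atgt_acommutor3, @revK C).
rewrite !arev_cat3 revK acompA ?E //= ?E // -nat.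
rewrite -!acompA ?atgt_comp //= ?E //.
congr (_ ⊙ (_ ⊙ _)); rewrite -!ajuxt_comp //= ?E // arevK.
by rewrite !acomp1l ?acomp1 ?E.
Qed.
End Commutor.

(** * Reversals of an interval inside a list, and their relations *)

(** An interval is given by its start and its length: s_(p,q) has length [q.+1 - p]. *)
Definition rev_at T (p m : nat) (s : seq T) : seq T :=
  take p s ++ rev (take m (drop p s)) ++ drop m (drop p s).

Lemma map_rev_at T T' (f : T -> T') p m s :
  map f (rev_at p m s) = rev_at p m (map f s).
Proof. by rewrite /rev_at !map_cat map_rev !(map_take, map_drop). Qed.

Lemma size_rev_at T p m (s : seq T) : size (rev_at p m s) = size s.
Proof.
rewrite -[in RHS](cat_take_drop p s) -[in RHS](cat_take_drop m (drop p s)).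
by rewrite !size_cat size_rev.
Qed.

Lemma cat_at T p m (s : seq T) : p + m <= size s ->
  exists a b c, [/\ s = a ++ b ++ c, size a = p & size b = m].
Proof.
move=> le; exists (take p s), (take m (drop p s)), (drop m (drop p s)).
by rewrite !cat_take_drop !size_takel ?size_drop; [|lia..].
Qed.

Lemma rev_at_cat T p m (s a b c : seq T) :
  s = a ++ b ++ c -> size a = p -> size b = m -> rev_at p m s = a ++ rev b ++ c.
Proof.
move=> -> <- <-; rewrite /rev_at !take_size_cat // !drop_size_cat //.
by rewrite take_size_cat.
Qed.

Section Reversals.
Variable C : coboundaryCat.
Implicit Types (s t u : seq C) (P Q R : arrow C).

Definition arev_at p m s : arrow C :=
  aid (take p s) ⊠ (arev (take m (drop p s)) ⊠ aid (drop m (drop p s))).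

Lemma asrc_arev_at p m s : asrc (arev_at p m s) = s.
Proof. by rewrite /= asrc_arev !cat_take_drop. Qed.

Lemma atgt_arev_at p m s : atgt (arev_at p m s) = rev_at p m s.
Proof. by rewrite /= atgt_arev. Qed.

Lemma arev_at_cat p m s a b c :
  s = a ++ b ++ c -> size a = p -> size b = m ->
  arev_at p m s = aid a ⊠ (arev b ⊠ aid c).
Proof.
move=> -> <- <-; rewrite /arev_at !take_size_cat // !drop_size_cat //.
by rewrite take_size_cat.
Qed.

Lemma arev_atK p m s : p + m <= size s ->
  arev_at p m (rev_at p m s) ⊙ arev_at p m s = aid s.
Proof.
move=> /cat_at [a [b [c [-> pa mb]]]].
rewrite (rev_at_cat (a := a) (b := b) (c := c)) //.
rewrite (arev_at_cat (a := a) (b := rev b) (c := c)) ?size_rev //.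
rewrite (arev_at_cat (a := a) (b := b) (c := c)) //.
rewrite -!ajuxt_comp //= ?asrc_arev ?atgt_arev // !acomp1 // arevK.
by rewrite !ajuxt_id.
Qed.

Lemma arev_at_disjoint p m k l s : p + m <= k -> k + l <= size s ->
  arev_at k l (rev_at p m s) ⊙ arev_at p m s
  = arev_at p m (rev_at k l s) ⊙ arev_at k l s.
Proof.
move=> pmk kls.
have [|a [b [s' [es pa mb]]]] := @cat_at _ p m s; first by lia.
move: kls; rewrite {s}es !size_cat => kls.
have [|c [d [e [-> kc ld]]]] := @cat_at _ (k - (p + m)) l s'; first by lia.
rewrite (rev_at_cat (p := p) (a := a) (b := b) (c := c ++ d ++ e)) //.
rewrite (rev_at_cat (p := k) (a := a ++ b ++ c) (b := d) (c := e)) ?size_cat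
  -?catA //; last by lia.
rewrite (arev_at_cat (p := k) (a := a ++ rev b ++ c) (b := d) (c := e))
  ?size_cat ?size_rev -?catA //; last by lia.
rewrite (arev_at_cat (p := k) (a := a ++ b ++ c) (b := d) (c := e))
  ?size_cat ?size_rev -?catA //; last by lia.
rewrite (arev_at_cat (a := a) (b := b) (c := c ++ d ++ e)) //.
rewrite (arev_at_cat (a := a) (b := b) (c := c ++ rev d ++ e)) //.
have E := (@asrc_arev C, @atgt_arev C).
rewrite -!ajuxt_id -!ajuxtA -!ajuxt_comp //= ?E //.
by rewrite !acomp1 ?acomp1l ?E.
Qed.

(** [k] is the offset of the inner interval after the outer reversal; beforehand it has the mirrored
    offset [m - (k + l)]. Cutting the outer interval around the inner one reduces the claim to
    [arev_nested]. *)
Lemma arev_at_nested p m k l s : k + l <= m -> p + m <= size s ->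
  arev_at (p + k) l (rev_at p m s) ⊙ arev_at p m s
  = arev_at p m (rev_at (p + (m - (k + l))) l s)
    ⊙ arev_at (p + (m - (k + l))) l s.
Proof.
move=> klm /cat_at [x [r [y [-> px mr]]]].
have [|a [b [c [er ak bl]]]] := @cat_at _ (m - (k + l)) l r; first by lia.
have kc : size c = k by move: mr; rewrite er !size_cat; lia.
have m_ : m = size (a ++ b ++ c) by rewrite -er mr.
rewrite er; move: mr; rewrite er => mr.
rewrite (rev_at_cat (p := p) (a := x) (b := a ++ b ++ c) (c := y)) //.
rewrite (arev_at_cat (p := p) (a := x) (b := a ++ b ++ c) (c := y)) //.
have pxa : size (x ++ a) = p + (m - (k + l)) by rewrite size_cat px ak.
rewrite (rev_at_cat (p := p + (m - (k + l))) (a := x ++ a) (b := b)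
  (c := c ++ y)) -?catA //.
rewrite (arev_at_cat (p := p + (m - (k + l))) (a := x ++ a) (b := b)
  (c := c ++ y)) -?catA //.
rewrite (arev_at_cat (p := p + k) (a := x ++ rev c) (b := rev b)
  (c := rev a ++ y)) ?size_cat ?size_rev ?px ?kc ?rev_cat -?catA //.
rewrite (arev_at_cat (p := p) (a := x) (b := a ++ rev b ++ c) (c := y))
  -?catA //; last by rewrite -mr !size_cat size_rev.
have E := (@asrc_arev C, @atgt_arev C).
rewrite -!ajuxt_id -!ajuxtA.
rewrite (ajuxtA (arev (rev b))) (ajuxtA (aid (rev c))) (ajuxtA (arev b)).
rewrite (ajuxtA (aid a)) -!ajuxt_comp //= ?E ?rev_cat -?catA //.
by rewrite (ajuxtA (aid (rev c))) arev_nested.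
Qed.

Section Naturality.
Variables (I : Type) (A B : I -> C) (f : forall i, Hom (A i) (B i)).

Definition amap (v : seq I) : arrow C := Arrow (tens_map f v).

Lemma amap_cons i v :
  amap (i :: v) = Arrow (f i : Hom (tens [:: A i]) (tens [:: B i])) ⊠ amap v.
Proof.
case: v => [|j v]; first by rewrite [RHS]ajuxt_nilr.
by rewrite /ajuxt juxtE /= comp1m compm1.
Qed.

Lemma amap_cat v w : amap (v ++ w) = amap v ⊠ amap w.
Proof.
elim: v => [|i v IH]; first by rewrite [RHS]ajuxt_nill.
by rewrite cat_cons !amap_cons IH ajuxtA.
Qed.

Lemma arev_nat v :
  arev (map B v) ⊙ amap v = amap (rev v) ⊙ arev (map A v).
Proof.
elim: v => [|i v IH]; first by rewrite /= acomp1 // acomp1l.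
have E := (@asrc_arev C, @atgt_arev C, @map_rev I).
rewrite rev_cons -cats1 amap_cat amap_cons [amap [:: i]]amap_cons.
rewrite [amap [::]]/(aid [::]) ajuxt_nilr /=.
rewrite -acompA /= ?atgt_comp /= ?E // -ajuxt_comp /= ?E // IH.
rewrite acompA /= ?atgt_comp /= ?E //.
set h := Arrow _.
have := acommutor_nat h (amap (rev v)); rewrite /= !map_rev => <-.
rewrite -acompA /= ?E // -ajuxt_comp /= ?E //.
by rewrite acomp1 // acomp1l.
Qed.

Lemma arev_at_nat p m v :
  arev_at p m (map B v) ⊙ amap v = amap (rev_at p m v) ⊙ arev_at p m (map A v).
Proof.
have E := (@asrc_arev C, @atgt_arev C, @map_rev I).
rewrite -[in amap v](cat_take_drop p v) -(cat_take_drop m (drop p v)).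
rewrite /arev_at /rev_at -!map_drop -!map_take !amap_cat.
rewrite -!ajuxt_comp /= ?E // arev_nat.
by rewrite ?acomp1l ?acomp1.
Qed.
End Naturality.
End Reversals.

(** * Action of words in the cactus generators *)

Lemma rev_permE n (p q i : 'I_n) :
  val (rev_perm p q i) = if p <= i <= q then p + q - i else i.
Proof.
rewrite permE /rev_fun; case: ifP => // h; rewrite val_insubd.
by have := ltn_ord q; case: ifP; lia.
Qed.

Section Words.
Variable n : nat.
Implicit Types (g h : cactus_gen n) (w : word (cactus_gen n)).

Definition gen_len g := (val g).2.+1 - (val g).1.

Definition rev_gen g T (s : seq T) := rev_at (val g).1 (gen_len g) s.

(** Letters act from left to right, and their signs are ignored because reversals are
    involutions. *)
Definition perm_word w T (s : seq T) :=
  foldl (fun s x => rev_gen x.1 s) s w.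

Lemma gen_len_size g : (val g).1 + gen_len g <= n.
Proof.
by case: g => -[p q] /= pq; have := ltn_ord q; rewrite /gen_len /=; lia.
Qed.

Lemma size_perm_word w T (s : seq T) : size (perm_word w s) = size s.
Proof. by elim: w s => //= x w IH s; rewrite IH size_rev_at. Qed.

Lemma map_perm_word w T T' (f : T -> T') s :
  map f (perm_word w s) = perm_word w (map f s).
Proof. by elim: w s => //= x w IH s; rewrite IH /rev_gen map_rev_at. Qed.

Lemma rev_gen_enum g :
  rev_gen g (enum 'I_n) = map (gen_perm g) (enum 'I_n).
Proof.
apply: (inj_map val_inj); rewrite map_rev_at val_enum_ord.
apply: (@eq_from_nth _ 0); rewrite size_rev_at size_iota ?size_map.
  by rewrite -enumT size_enum_ord.
move=> i lti; pose j := Ordinal lti.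
rewrite -map_comp (nth_map j) ?size_enum_ord //.
rewrite -[X in nth j _ X]/(val j) nth_ord_enum /= rev_permE /=.
case: g => -[p q] /= pq; have ltq := ltn_ord q; rewrite /gen_len /= in pq *.
rewrite /rev_at !(drop_iota, take_iota) !nth_cat !size_rev !size_iota.
have -> : minn p n = p by lia.
have -> : minn (q.+1 - p) (n - p) = q.+1 - p by lia.
do !case: ifP => ?; rewrite ?nth_rev ?size_iota ?nth_iota; lia.
Qed.

Lemma perm_word_enum w :
  perm_word w (enum 'I_n) = map (word_val (@gen_perm n) w)^-1%g (enum 'I_n).
Proof.
elim: w => [|[g b] w IH] /=.
  rewrite -[LHS]map_id; apply: eq_map => i.
  by rewrite /word_val big_nil invg1 perm1.
rewrite rev_gen_enum -map_perm_word IH -map_comp; apply: eq_map => i /=.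
rewrite /word_val big_cons invMg permM /=; congr (fun_of_perm _ _).
have gV : (gen_perm g)^-1%g = gen_perm g.
  by apply/eqP; rewrite eq_invg_mul gen_permK.
by case: b; rewrite !gV.
Qed.

Section Action.
Variable C : coboundaryCat.
Implicit Types s : seq C.

Fixpoint act_word w s : arrow C :=
  if w is x :: w' then
    act_word w' (rev_gen x.1 s) ⊙ arev_at (val x.1).1 (gen_len x.1) s
  else aid s.

Lemma asrc_act_word w s : asrc (act_word w s) = s.
Proof. by elim: w s => //= x w IH s; rewrite asrc_comp asrc_arev_at. Qed.

Lemma atgt_act_word w s : atgt (act_word w s) = perm_word w s.
Proof.
elim: w s => //= x w IH s.
by rewrite atgt_comp ?IH // atgt_arev_at asrc_act_word.
Qed.

Lemma act_word_cat w w' s :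
  act_word (w ++ w') s = act_word w' (perm_word w s) ⊙ act_word w s.
Proof.
elim: w s => [|x w IH] s /=; first by rewrite acomp1 ?asrc_act_word.
by rewrite IH acompA ?asrc_act_word ?atgt_act_word ?atgt_arev_at.
Qed.

Lemma act_word1 g b s :
  act_word [:: (g, b)] s = arev_at (val g).1 (gen_len g) s.
Proof. by rewrite /= acomp1l ?atgt_arev_at. Qed.

Lemma act_word2 g b h c s : act_word [:: (g, b); (h, c)] s =
  arev_at (val h).1 (gen_len h) (rev_gen g s) ⊙ arev_at (val g).1 (gen_len g) s.
Proof. by rewrite -cat1s act_word_cat !act_word1. Qed.

Lemma act_word_rel u v s : cactus_rel u v -> size s = n ->
  act_word (pos_word u) s = act_word (pos_word v) s.
Proof.
case=> [g|g h dis|g h h' pk lq ek el] sn;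
  have gp : (val g).1 < (val g).2 := valP g.
- by rewrite act_word2 arev_atK // sn gen_len_size.
- have hp : (val h).1 < (val h).2 := valP h.
  rewrite !act_word2 /rev_gen; case: dis => dis; [|symmetry];
    apply: arev_at_disjoint; rewrite ?sn ?gen_len_size // /gen_len; lia.
rewrite !act_word2 /rev_gen.
have hp : (val h).1 < (val h).2 := valP h.
have h'p : (val h').1 < (val h').2 := valP h'.
have {}ek : (val h').1 = (val g).1 + (val g).2 - (val h).2 :> nat.
  by rewrite ek rev_permE ifT //; lia.
have {}el : (val h').2 = (val g).1 + (val g).2 - (val h).1 :> nat.
  by rewrite el rev_permE ifT //; lia.
have := @arev_at_nested C (val g).1 (gen_len g) ((val h).1 - (val g).1)
  (gen_len h) s; rewrite sn => /(_ _ (gen_len_size g)) H.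
have e1 : (val g).1 + ((val h).1 - (val g).1) = (val h).1 :> nat by lia.
have e2 : gen_len h' = gen_len h by rewrite /gen_len; lia.
have e3 : (val g).1 + (gen_len g - ((val h).1 - (val g).1 + gen_len h))
    = (val h').1 :> nat.
  by rewrite /gen_len; lia.
by rewrite -e1 H ?e3 ?e2 // /gen_len; lia.
Qed.

Lemma act_word_eq w w' s : pres_eq (@cactus_rel n) w w' -> size s = n ->
  act_word w s = act_word w' s.
Proof.
move=> ww'; elim: ww' s => // {w w'} [u v uv|g b|w1 w1' w2 w2' _ e1 _ e2|
    w w' _ e|w1 w2 w3 _ e1 _ e2] s sn.
- exact: act_word_rel.
- by rewrite act_word2 arev_atK // sn gen_len_size.
- rewrite !act_word_cat e1 // e2 ?size_perm_word //.
  (* Equal arrows have equal targets, so [w1] and [w1'] permute [s] alike. *)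
  by rewrite -[perm_word w1 s]atgt_act_word e1 // atgt_act_word.
- by rewrite e.
- by rewrite e1 ?e2.
Qed.

Lemma act_wordVK w s : size s = n ->
  act_word (inv_word w) (perm_word w s) ⊙ act_word w s = aid s.
Proof.
by move=> sn; rewrite -act_word_cat (act_word_eq (pres_mulV _ _) sn).
Qed.

Lemma perm_wordVK w s : size s = n ->
  perm_word (inv_word w) (perm_word w s) = s.
Proof.
move=> sn; have := congr1 (@atgt C) (act_wordVK w sn).
by rewrite atgt_comp ?atgt_act_word ?asrc_act_word.
Qed.

Lemma act_wordKV w s : size s = n ->
  act_word w s ⊙ act_word (inv_word w) (perm_word w s) = aid (perm_word w s).
Proof.
move=> sn; have := @act_wordVK (inv_word w) (perm_word w s).
by rewrite inv_wordK perm_wordVK // size_perm_word => ->.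
Qed.

Lemma act_word_nat I (A B : I -> C) (f : forall i, Hom (A i) (B i)) w v :
  act_word w (map B v) ⊙ amap f v
  = amap f (perm_word w v) ⊙ act_word w (map A v).
Proof.
elim: w v => [|x w IH] v /=; first by rewrite acomp1 // acomp1l.
have E := (@asrc_arev_at C, @atgt_arev_at C, asrc_act_word, atgt_act_word).
rewrite -acompA ?E // arev_at_nat acompA ?E //=; last 2 first.
- by rewrite /rev_gen map_rev_at.
- by rewrite map_rev_at.
by rewrite /rev_gen -map_rev_at IH -acompA ?E //= ?map_perm_word ?map_rev_at.
Qed.

End Action.
End Words.

(** * Commutors of blocks in terms of reversals *)

Lemma rev_at1 T p (s : seq T) : p < size s -> rev_at p 1 s = s.
Proof.
move=> ps; have [|a [b [c [-> pa b1]]]] := @cat_at _ p 1 s; first by lia.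
by rewrite (rev_at_cat (a := a) (b := b) (c := c)) //; case: b b1 => [|x []].
Qed.

Lemma cat_blocks_at T p r q (s : seq T) : p <= r -> r < q -> q < size s ->
  exists a b c d, [/\ s = a ++ b ++ c ++ d, size a = p, size b = r.+1 - p
    & size c = q - r].
Proof.
move=> pr rq qs; have [|a [b [s' [es pa br]]]] := @cat_at _ p (r.+1 - p) s.
  by lia.
move: qs; rewrite {s}es !size_cat => qs.
have [|x [c [d [-> x0 cq]]]] := @cat_at _ 0 (q - r) s'; first by lia.
by exists a, b, c, d; rewrite (size0nil x0).
Qed.

Lemma blocks_cat T p r q (s a b c d : seq T) : s = a ++ b ++ c ++ d ->
  size a = p -> size b = r.+1 - p -> size c = q - r ->
  [/\ block0 p s = a, block1 p r s = b, block2 p r q s = c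
    & block3 p r q s = d].
Proof.
rewrite /block0 /block1 /block2 /block3 => -> <- <- <-.
by rewrite !(drop_size_cat, take_size_cat).
Qed.

Lemma swap_blocks_rev_at T p r q (s : seq T) : p <= r -> r < q -> q < size s ->
  swap_blocks p r q s
  = rev_at p (q.+1 - p) (rev_at r.+1 (q - r) (rev_at p (r.+1 - p) s)).
Proof.
move=> pr rq /(cat_blocks_at pr rq) [a [b [c [d [es pa br cq]]]]].
have [e0 e1 e2 e3] := blocks_cat es pa br cq.
rewrite /swap_blocks e0 e1 e2 e3 (rev_at_cat es) //.
have rE : size (a ++ rev b) = r.+1 by rewrite size_cat size_rev; lia.
have qE : size (rev b ++ rev c) = q.+1 - p by rewrite size_cat !size_rev; lia.
rewrite (rev_at_cat (p := r.+1) (a := a ++ rev b) (b := c) (c := d)) -?catA //.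
rewrite (rev_at_cat (a := a) (b := rev b ++ rev c) (c := d)) -?catA //.
by rewrite rev_cat !revK -!catA.
Qed.

Section CommutorBlocks.
Variable C : coboundaryCat.
Implicit Types s : seq C.

Definition acommutor_blocks p r q s : arrow C :=
  aid (block0 p s)
  ⊠ (acommutor (block1 p r s) (block2 p r q s) ⊠ aid (block3 p r q s)).

Lemma acommutor_blocksE s t t' u :
  Arrow (commutor_blocks s t t' u) = aid s ⊠ (acommutor t t' ⊠ aid u).
Proof. by rewrite /ajuxt /= !juxtE commutor_tensE. Qed.

Lemma asrc_commutor_blocks p r q s : asrc (acommutor_blocks p r q s) = s.
Proof. by rewrite /= -cat_blocks. Qed.

(* By arev_cat, the reversal of rev b ++ rev c after those of b and c is the *)
(* commutor of b and c, all the other factors cancelling by arevK.           *)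
Lemma acommutor_blocks_arev p r q s : p <= r -> r < q -> q < size s ->
  acommutor_blocks p r q s
  = arev_at p (q.+1 - p) (rev_at r.+1 (q - r) (rev_at p (r.+1 - p) s))
    ⊙ (arev_at r.+1 (q - r) (rev_at p (r.+1 - p) s)
    ⊙ arev_at p (r.+1 - p) s).
Proof.
move=> pr rq /(cat_blocks_at pr rq) [a [b [c [d [es pa br cq]]]]].
have [e0 e1 e2 e3] := blocks_cat es pa br cq.
rewrite /acommutor_blocks e0 e1 e2 e3 (rev_at_cat es) // (arev_at_cat es) //.
have rE : size (a ++ rev b) = r.+1 by rewrite size_cat size_rev; lia.
rewrite (rev_at_cat (p := r.+1) (a := a ++ rev b) (b := c) (c := d)) -?catA //.
rewrite (arev_at_cat (p := r.+1) (a := a ++ rev b) (b := c) (c := d)) -?catA //.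
have qE : size (rev b ++ rev c) = q.+1 - p by rewrite size_cat !size_rev; lia.
rewrite (arev_at_cat (a := a) (b := rev b ++ rev c) (c := d)) -?catA //.
have E := (@asrc_arev C, @atgt_arev C).
rewrite -!ajuxt_id -!ajuxtA (ajuxtA (arev b)) (ajuxtA (aid (rev b))).
rewrite -!ajuxt_comp //= ?E ?atgt_comp //= ?E // arev_cat !revK.
rewrite [aid (rev b) ⊙ arev b]acomp1l ?[arev c ⊙ aid c]acomp1 ?E //.
rewrite -acompA /= ?E ?revK // -ajuxt_comp /= ?E // !arevK ajuxt_id.
by rewrite !acomp1.
Qed.

(** The recursion s_(p,q) = σ_(p,p,q) s_(p+1,q) is the defining recursion of [arev], with the factor
    at position [p] as its head. *)
Lemma acommutor_blocks_step d p s : p + d.+1 < size s ->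
  acommutor_blocks p p (p + d.+1) (rev_at p.+1 d.+1 s) ⊙ arev_at p.+1 d.+1 s
  = arev_at p d.+2 s.
Proof.
move=> pds; have ppd : p < p + d.+1 by lia.
have [a [b [c [d' [es pa br cq]]]]] := cat_blocks_at (leqnn p) ppd pds.
have cd : size c = d.+1 by lia.
have [x eb] : exists x, b = [:: x].
  by case: b br {es} => [|x [|y b]] /=; [lia|exists x|lia].
rewrite {b}eb in br es.
have pE : size (a ++ [:: x]) = p.+1 by rewrite size_cat pa addn1.
have dE : size ([:: x] ++ c) = d.+2 by rewrite size_cat cd.
rewrite (rev_at_cat (a := a ++ [:: x]) (b := c) (c := d')) -?catA //.
rewrite (arev_at_cat (a := a ++ [:: x]) (b := c) (c := d')) -?catA //.
rewrite (arev_at_cat (a := a) (b := [:: x] ++ c) (c := d')) -?catA //.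
have cr : size (rev c) = p + d.+1 - p by rewrite size_rev.
have [e0 e1 e2 e3] := blocks_cat (d := d') erefl pa br cr.
rewrite /acommutor_blocks e0 e1 e2 e3 -ajuxt_id -!ajuxtA.
rewrite (ajuxtA (aid [:: x])) -!ajuxt_comp /= ?atgt_arev //.
by rewrite !acomp1.
Qed.

Lemma arev_at1 p s : p < size s -> arev_at p 1 s = aid s.
Proof.
move=> ps; have [|a [b [c [es pa b1]]]] := @cat_at _ p 1 s; first by lia.
rewrite (arev_at_cat es) //; case: b b1 es => [|x []] // _ ->.
by rewrite arev1 !ajuxt_id.
Qed.
End CommutorBlocks.

(** * The transformations [tau] and the composites of commutors *)

Section CactusAction.
Variables (C : coboundaryCat) (n : nat).
Implicit Types (A B : 'I_n -> C) (w : 'I_n -> 'I_n).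
Local Notation factors A := [seq A i | i <- enum 'I_n].

Lemma size_factors T (A : 'I_n -> T) : size (map A (enum 'I_n)) = n.
Proof. by rewrite size_map size_enum_ord. Qed.

Definition transf_arrow w (th : transf C w) A : arrow C :=
  @Arrow C (factors A) (factors (A \o w)) (th A).

Lemma transf_eqP w w' (th : transf C w) (th' : transf C w') :
  th ≡ th' <-> w =1 w' /\ (forall A, transf_arrow th A = transf_arrow th' A).
Proof.
split=> [[e eA]|[e eA]].
  by split=> // A; rewrite /transf_arrow -eA Arrow_castl.
exists e => A; apply: (@Arrow_inj C); rewrite Arrow_castl; exact: eA.
Qed.

Lemma transf_eq_refl w (th : transf C w) : th ≡ th.
Proof. exact/transf_eqP. Qed.

Lemma transf_eq_sym w w' (th : transf C w) (th' : transf C w') :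
  th ≡ th' -> th' ≡ th.
Proof. by move=> /transf_eqP [e eA]; apply/transf_eqP; split=> // A. Qed.

Lemma transf_eq_trans w1 w2 w3 (th1 : transf C w1) (th2 : transf C w2)
    (th3 : transf C w3) : th1 ≡ th2 -> th2 ≡ th3 -> th1 ≡ th3.
Proof.
move=> /transf_eqP [e eA] /transf_eqP [e' eA']; apply/transf_eqP.
by split=> [i|A]; rewrite ?e ?eA.
Qed.

Lemma transf_arrow_comp w w' (th : transf C w) (th' : transf C w') A :
  transf_arrow (transf_comp th th') A
  = transf_arrow th' (A \o w) ⊙ transf_arrow th A.
Proof. by rewrite [RHS]acompE. Qed.

Lemma transf_comp_eq w1 w1' w2 w2' (th1 : transf C w1) (th1' : transf C w1')
    (th2 : transf C w2) (th2' : transf C w2') :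
  th1 ≡ th1' -> th2 ≡ th2' -> transf_comp th1 th2 ≡ transf_comp th1' th2'.
Proof.
move=> /transf_eqP [e1 eA1] /transf_eqP [e2 eA2]; apply/transf_eqP.
split=> [i|A] /=; first by rewrite e1 e2.
rewrite !transf_arrow_comp eA1 eA2; congr (transf_arrow _ _ ⊙ _).
(* The two families of factors must be equal as functions, while the index maps agree only
   pointwise. *)
by apply/funext => i /=; rewrite e1.
Qed.

Lemma transf_arrow_sigma p r q A :
  transf_arrow (sigma C n p r q) A = acommutor_blocks p r q (factors A).
Proof. by rewrite /transf_arrow Arrow_castr Arrow_castl acommutor_blocksE. Qed.

Lemma interval_rev_idxE d p (i : 'I_n) : p + d < n ->
  val (interval_rev_idx d p i) = if p <= i <= p + d then p + (p + d) - i else i.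
Proof.
elim: d p i => [|[|d] IH] p i pdn; first by rewrite /=; case: ifP; lia.
  by rewrite /= swap_idxE; [do !case: ifP; lia|lia..].
have idxE : interval_rev_idx d.+2 p i
  = interval_rev_idx d.+1 p.+1 (swap_idx p p (p + d.+2) i) by [].
rewrite idxE IH; last by lia.
by rewrite swap_idxE; [do !case: ifP; lia|lia..].
Qed.

Lemma transf_arrow_interval_rev d p A : p + d < n ->
  transf_arrow (@interval_rev_rec C n d p) A = arev_at p d.+1 (factors A).
Proof.
elim: d p A => [|[|d] IH] p A pdn.
- by rewrite arev_at1 // size_factors; lia.
- rewrite transf_arrow_sigma -acommutor_blocks_step ?size_factors ?addn1 //;
    last by lia.
  have p1n : p.+1 < n by lia.
  by rewrite rev_at1 ?arev_at1 ?acomp1 ?asrc_commutor_blocks ?size_factors.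
have -> : transf_arrow (@interval_rev_rec C n d.+2 p) A
  = transf_arrow (sigma C n p p (p + d.+2)) (A \o interval_rev_idx d.+1 p.+1)
    ⊙ transf_arrow (@interval_rev_rec C n d.+1 p.+1) A.
  exact: transf_arrow_comp.
have eA := IH p.+1 A; have {}eA := eA ltac:(lia).
(* Comparing targets identifies the list on which the next commutor acts. *)
have /= et := congr1 (@atgt C) eA.
rewrite transf_arrow_sigma eA -(acommutor_blocks_step (d := d.+1))
  ?size_factors //.
by rewrite [factors _]et atgt_arev.
Qed.

Lemma map_enum_inj T (f g : 'I_n -> T) :
  map f (enum 'I_n) = map g (enum 'I_n) -> f =1 g.
Proof. by move=> fg i; move/eq_in_map: fg; apply; rewrite mem_enum. Qed.

Lemma perm_word_cactus (w : word (cactus_gen n)) :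
  perm_word w (enum 'I_n)
  = map (cactus_perm (pres_class (@cactus_rel n) w)) (enum 'I_n).
Proof.
rewrite perm_word_enum /cactus_perm /pres_lift.
by rewrite (word_val_eq (@cactus_rel_perm n)
  (@pres_repr_class (cactus_gen n) (@cactus_rel n) w)).
Qed.

Lemma perm_word_factors (rho : cactus n) A :
  perm_word (pres_repr rho) (factors A) = factors (A \o cactus_perm rho).
Proof.
rewrite -map_perm_word perm_word_cactus pres_reprK -map_comp.
by apply: eq_map.
Qed.

Lemma tau_tgt (rho : cactus n) A :
  atgt (act_word (pres_repr rho) (factors A)) = factors (A \o cactus_perm rho).
Proof. by rewrite atgt_act_word perm_word_factors. Qed.

Definition tau (rho : cactus n) : transf C (cactus_perm rho) := fun A =>
  arrow_between (asrc_act_word (pres_repr rho) (factors A)) (tau_tgt rho A).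

Lemma transf_arrow_tau rho A :
  transf_arrow (tau rho) A = act_word (pres_repr rho) (factors A).
Proof. exact: arrow_betweenK. Qed.

Lemma transf_arrow_tau_class (w : word (cactus_gen n)) A :
  transf_arrow (tau (pres_class (@cactus_rel n) w)) A = act_word w (factors A).
Proof.
rewrite transf_arrow_tau; apply: act_word_eq (size_factors A).
exact: pres_repr_class.
Qed.

Lemma is_iso_arrow (s t : seq C) (f : Hom (tens s) (tens t)) (Q : arrow C) :
  asrc Q = t -> atgt Q = s -> Q ⊙ Arrow f = aid s -> Arrow f ⊙ Q = aid t ->
  is_iso f.
Proof.
case: Q => t' s' g /= et es; subst; rewrite !acompE => /(@Arrow_inj C) gf.
by move=> /(@Arrow_inj C) fg; exists g.
Qed.

Lemma amap_map I J (h : I -> J) (A B : J -> C) (f : forall j, Hom (A j) (B j))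
    (v : seq I) :
  amap f (map h v) = amap (fun i => f (h i) : Hom ((A \o h) i) ((B \o h) i)) v.
Proof. by elim: v => //= i v IH; rewrite !amap_cons IH. Qed.

Lemma tau_natural_iso rho : natural_iso (tau rho).
Proof.
split=> [A B f|A].
  apply: (@Arrow_inj C).
  rewrite -(@acompE C (factors A) (factors B)).
  rewrite -(@acompE C (factors A) (factors (A \o cactus_perm rho))).
  rewrite -/(transf_arrow (tau rho) A) -/(transf_arrow (tau rho) B).
  rewrite !transf_arrow_tau [LHS]act_word_nat.
  by rewrite perm_word_cactus pres_reprK amap_map.
have sA := size_factors A.
apply: (is_iso_arrow (Q := act_word (inv_word (pres_repr rho))
    (perm_word (pres_repr rho) (factors A)))).
- by rewrite asrc_act_word perm_word_factors.
- by rewrite atgt_act_word perm_wordVK.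
- by rewrite -/(transf_arrow (tau rho) A) transf_arrow_tau act_wordVK.
- rewrite -/(transf_arrow (tau rho) A) transf_arrow_tau act_wordKV //.
  by rewrite perm_word_factors.
Qed.

Lemma tau_gen (p q : 'I_n) (lt_pq : p < q) :
  tau (cactus_s lt_pq) ≡ interval_rev C n p q.
Proof.
have pq : p + (q - p) < n by have := ltn_ord q; lia.
apply/transf_eqP; split=> [i|A].
  rewrite cactus_perm_s; apply: val_inj; rewrite rev_permE interval_rev_idxE //.
  by rewrite subnKC // ltnW.
rewrite transf_arrow_interval_rev // -subSn ?(ltnW lt_pq) //.
by rewrite transf_arrow_tau_class act_word1.
Qed.

Lemma tauM (rho rho' : cactus n) :
  transf_comp (tau rho) (tau rho') ≡ tau (rho * rho')%g.
Proof.
apply/transf_eqP; split=> [i|A]; first by rewrite cactus_permM.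
rewrite transf_arrow_comp !transf_arrow_tau -perm_word_factors -act_word_cat.
by rewrite -(transf_arrow_tau_class (_ ++ _)) transf_arrow_tau.
Qed.

Lemma tau1 : tau 1%g ≡ transf_id C n.
Proof.
apply/transf_eqP; split=> [i|A].
  by apply: map_enum_inj i; rewrite -perm_word_cactus map_id.
by rewrite transf_arrow_tau_class.
Qed.

(** Blocks of a commutor may have a single factor, for which there is no generator; the empty word
    stands in. *)
Definition interval_word (p q : 'I_n) : word (cactus_gen n) :=
  if insub (p, q) is Some g then [:: (g, false)] else [::].

Lemma perm_interval_word (p q : 'I_n) T (s : seq T) : p <= q -> size s = n ->
  perm_word (interval_word p q) s = rev_at p (q.+1 - p) s.
Proof.
rewrite /interval_word => pq sn; case: insubP => [g _ eg|/=].
  by rewrite /= /rev_gen /gen_len eg.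
rewrite -leqNgt => qp; have -> : q.+1 - p = 1 by lia.
by rewrite rev_at1 // sn.
Qed.

Lemma act_interval_word (p q : 'I_n) (s : seq C) : p <= q -> size s = n ->
  act_word (interval_word p q) s = arev_at p (q.+1 - p) s.
Proof.
rewrite /interval_word => pq sn; case: insubP => [g _ eg|/=].
  by rewrite act_word1 /gen_len eg.
rewrite -leqNgt => qp; have -> : q.+1 - p = 1 by lia.
by rewrite arev_at1 // sn.
Qed.

Lemma sigma_tau p r q : p <= r -> r < q -> q < n ->
  exists rho, tau rho ≡ sigma C n p r q.
Proof.
move=> pr rq qn.
have [pn [rn r1n]] : p < n /\ r < n /\ r.+1 < n by lia.
pose p' := Ordinal pn; pose r' := Ordinal rn; pose q' := Ordinal qn.
pose s' := Ordinal r1n.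
(* Reverse each block, then their union: the word behind [acommutor_blocks_arev]. *)
pose w := interval_word p' r' ++ interval_word s' q' ++ interval_word p' q'.
have pq : p <= q by lia.
have qr : q.+1 - r.+1 = q - r by lia.
exists (pres_class _ w); apply/transf_eqP; split=> [|A].
  apply: map_enum_inj; rewrite -perm_word_cactus map_swap_idx /perm_word.
  rewrite !foldl_cat -!/(perm_word _ _) swap_blocks_rev_at ?size_enum_ord //.
  have sn := size_enum_ord n.
  by rewrite !perm_interval_word ?size_rev_at //= qr.
rewrite transf_arrow_tau_class transf_arrow_sigma.
have sn := size_factors A.
rewrite acommutor_blocks_arev ?sn // !act_word_cat.
rewrite !perm_interval_word ?size_rev_at // !act_interval_word ?size_rev_at //=.
by rewrite qr acompA // ?atgt_arev_at ?asrc_arev_at.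
Qed.

(** The constructors append one commutor at a time, so induction runs on the transformation applied
    last. *)
Lemma sigma_composite_transf_comp w (th : transf C w) w' (th' : transf C w') :
  sigma_composite th -> sigma_composite th' ->
  sigma_composite (transf_comp th th').
Proof.
move=> sth sth'; elim: sth' => {w' th'} [|w' th' p r q pr rq qn _ IH|
    w1 w2 th1 th2 e _ IH].
- apply: sigma_composite_eq sth; apply/transf_eqP; split=> // A.
  by rewrite transf_arrow_comp [RHS]acomp1l.
- apply: sigma_composite_eq (sigma_composite_comp pr rq qn IH).
  apply/transf_eqP; split=> // A.
  by rewrite !transf_arrow_comp acompA.
- apply: sigma_composite_eq IH; apply: transf_comp_eq e.
  exact: transf_eq_refl.
Qed.

Lemma sigma_composite_sigma p r q : p <= r -> r < q -> q < n ->
  sigma_composite (sigma C n p r q).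
Proof.
move=> pr rq qn.
apply: sigma_composite_eq
  (sigma_composite_comp pr rq qn (sigma_composite_id _ _)).
apply/transf_eqP; split=> // A.
by rewrite transf_arrow_comp acomp1.
Qed.

Lemma sigma_composite_interval_rev d p : p + d < n ->
  sigma_composite (@interval_rev_rec C n d p).
Proof.
elim: d p => [|[|d] IH] p pdn; first exact: sigma_composite_id.
  by apply: sigma_composite_sigma; lia.
have sc : sigma_composite (@interval_rev_rec C n d.+1 p.+1) by apply: IH; lia.
by apply: (sigma_composite_comp _ _ _ sc); lia.
Qed.

Lemma sigma_composite_tau rho : sigma_composite (tau rho).
Proof.
have gen g : sigma_composite (tau (pres_gen _ g)).
  case: g => -[p q] /= pq.
  apply: sigma_composite_eq (transf_eq_sym (tau_gen pq)) _.
  by apply: sigma_composite_interval_rev; have := ltn_ord q; lia.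
(* A formal inverse letter acts exactly as the generator. *)
have gen' g b : sigma_composite (tau (pres_class _ [:: (g, b)])).
  case: b (gen g) => //; apply: sigma_composite_eq.
  apply/transf_eqP; split=> [|A].
    by apply: map_enum_inj; rewrite -!perm_word_cactus.
  by rewrite !transf_arrow_tau_class !act_word1.
rewrite -(pres_reprK rho); elim: (pres_repr rho) => [|[g b] w IH].
  exact: sigma_composite_eq (transf_eq_sym tau1) (sigma_composite_id _ _).
have -> : pres_class (@cactus_rel n) ((g, b) :: w)
    = (pres_class (@cactus_rel n) [:: (g, b)] * pres_class (@cactus_rel n) w)%g.
  by rewrite -pres_class_cat.
apply: sigma_composite_eq (tauM _ _) _.
exact: sigma_composite_transf_comp (gen' g b) IH.
Qed.

Lemma sigma_compositeP w (th : transf C w) :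
  sigma_composite th <-> exists rho, tau rho ≡ th.
Proof.
split=> [|[rho e]]; last exact: sigma_composite_eq e (sigma_composite_tau rho).
elim=> {w th} [|w th p r q pr rq qn _ [rho e]|w w' th th' e _ [rho e']].
- by exists 1%g; exact: tau1.
- have [rho' e'] := sigma_tau pr rq qn; exists (rho * rho')%g.
  apply: transf_eq_trans (transf_eq_sym (tauM _ _)) _.
  exact: transf_comp_eq.
- by exists rho; apply: transf_eq_trans e' e.
Qed.
End CactusAction.

Theorem theorem7 (C : coboundaryCat) (n : nat) :
  exists tau : forall rho : cactus n, transf C (cactus_perm rho),
    [/\ forall rho : cactus n, natural_iso (tau rho),
        forall (p q : 'I_n) (lt_pq : p < q),
          tau (cactus_s lt_pq) ≡ interval_rev C n p q,
        forall rho rho' : cactus n,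
          transf_comp (tau rho) (tau rho') ≡ tau (rho * rho')%g
      & forall (w : 'I_n -> 'I_n) (th : transf C w),
          sigma_composite th <-> exists rho : cactus n, tau rho ≡ th].
Proof.
exists (@tau C n); split.
- exact: tau_natural_iso.
- exact: tau_gen.
- exact: tauM.
- by move=> w th; apply: sigma_compositeP.
Qed.
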